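(* $\mathsf{BIM}$ proves the equivalence of: (i) $\mathbf{FT_{ext}}$: for all $\beta,\alpha$, if $Fan^+(\beta)$ and $D_\alpha$ is a bar in $\mathcal F_\beta$, then there is $n$ such that $D_{\overline\alpha n}$ is a bar in $\mathcal F_\beta$; (ii) for all $\beta$ with $Fan^+(\beta)$ and all $\alpha$, if $D_\alpha$ is a thin bar in $\mathcal F_\beta$, then $\exists n\forall m>n[\alpha(m)=0]$.
   Context: $\mathsf{BIM}$ is the two-sorted intuitionistic theory of natural numbers and functions $\mathbb N\to\mathbb N$ with extensionality, primitive recursive constants, closure of functions under composition, primitive recursion and unbounded search, and full induction. Finite sequences are coded by naturals ($s\ast\langle n\rangle$ appending $n$, $\overline\alpha n=\langle\alpha(0),\dots,\alpha(n-1)\rangle$, $s\sqsubseteq t$ iff $s$ is an initial part of $t$). $D_\alpha=\{n\mid\alpha(n)\ne0\}$; for a code $a$, $D_a=\{i<length(a)\mid a(i)\ne0\}$. $\mathcal F_\beta=\{\alpha\mid\forall n[\beta(\overline\alpha n)=0]\}$. $\beta$ is a spread-law if $\forall s[\beta(s)=0\leftrightarrow\exists n[\beta(s\ast\langle n\rangle)=0]]$; $Fan^+(\beta)$ means $\beta$ is a spread-law and there is $\gamma$ with $\forall s\forall m[\beta(s\ast\langle m\rangle)=0\rightarrow m\le\gamma(s)]$. $B$ is a bar in $\mathcal F_\beta$ if $\forall\gamma\in\mathcal F_\beta\exists n[\overline\gamma n\in B]$, and a thin bar if moreover $s,t\in B$, $s\sqsubseteq t$ imply $s=t$.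
   Formalization: A thin bar in F_β is additionally required to consist of admitted sequences (α(s)≠0 implies β(s)=0); without this, (ii) is refutable: let F_β contain only the zero sequence and D_α be all sequences of length 1. *)

(* Defs.v *)
From Stdlib Require Import List Vector.
Import ListNotations.
Import VectorNotations.

(** * Primitive recursive function symbols *)

Inductive pr : nat -> Type :=
| PZero : pr 0
| PSucc : pr 1
| PProj n (i : Fin.t n) : pr n
| PComp m n (f : pr m) (gs : Vector.t (pr n) m) : pr n
| PRec n (f : pr n) (g : pr (S (S n))) : pr (S n).

Arguments PProj {n} i.
Arguments PComp {m n} f gs.
Arguments PRec {n} f g.

Declare Scope pr_scope.
Delimit Scope pr_scope with pr.
Notation "f ∘ gs" := (PComp f gs%vector) (at level 40, no associativity) : pr_scope.
Local Open Scope pr_scope.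

Local Notation p0 := (PProj Fin.F1).
Local Notation p1 := (PProj (Fin.FS Fin.F1)).
Local Notation p2 := (PProj (Fin.FS (Fin.FS Fin.F1))).

Definition pzero {n} : pr n := PZero ∘ [].
(** [padd(x,y) = x + y], by recursion on [x]. *)
Definition padd : pr 2 := PRec p0 (PSucc ∘ [p1]).
Definition ppred : pr 1 := PRec PZero p0.
(** [psub(x,y) = x - y], truncated. *)
Definition psub : pr 2 := PRec p0 (ppred ∘ [p1]) ∘ [p1; p0].
(** [pnull(0) = 1] and [pnull(S x) = 0]. *)
Definition pnull : pr 1 := PRec (PSucc ∘ [PZero]) pzero.
(** [ptri(x) = 0 + 1 + ... + x]. *)
Definition ptri : pr 1 := PRec PZero (padd ∘ [PSucc ∘ [p0]; p1]).

(** Cantor's bijective pairing [J(x,y) = ptri(x + y) + x], with inverses [K], [L];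
    [pdiag(z)], the largest [w] with [ptri(w) <= z], is [K(z) + L(z)]. *)
Definition pJ : pr 2 := padd ∘ [ptri ∘ [padd]; p0].
Definition pdiag : pr 1 :=
  PRec PZero (padd ∘ [pnull ∘ [psub ∘ [ptri ∘ [PSucc ∘ [p1]]; PSucc ∘ [p0]]]; p1]).
Definition pK : pr 1 := psub ∘ [p0; ptri ∘ [pdiag]].
Definition pL : pr 1 := psub ∘ [pdiag; pK].

(** Finite sequences are coded bijectively by all the natural numbers:
    [0] codes the empty sequence and [s * <n> = S (J(s,n))]. *)
Definition psnoc : pr 2 := PSucc ∘ [pJ].
(** [pcut(k,s)] is [s] without its last [k] elements. *)
Definition pcut : pr 2 := PRec p0 (pK ∘ [ppred ∘ [p1]]).
(** As [s < s * <n>], the length of [s] is the number of [k < s] with [pcut(k,s) <> 0]. *)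
Definition plen : pr 1 :=
  PRec pzero (padd ∘ [pnull ∘ [pnull ∘ [pcut ∘ [p0; p2]]]; p1]) ∘ [p0; p0].
(** [pent(s,i) = s(i)], for [i] smaller than the length of [s]. *)
Definition pent : pr 2 :=
  pL ∘ [ppred ∘ [pcut ∘ [psub ∘ [plen ∘ [p0]; PSucc ∘ [p1]]; p0]]].

Local Close Scope pr_scope.

(** * Two-sorted terms and formulas

    De Bruijn indices, counted separately for number variables and for function variables:
    [AllN], [ExN] bind number variable 0, and [AllF], [ExF] bind function variable 0. *)

Inductive fterm :=
| FVar (k : nat)
| FPr (f : pr 1).

Inductive nterm :=
| NVar (k : nat)
| NPr n (f : pr n) (ts : Vector.t nterm n)
| NAp (f : fterm) (t : nterm).

Arguments NPr {n} f ts.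

Inductive form :=
| EqN (t u : nterm)
| EqF (f g : fterm)
| Bot
| And (A B : form)
| Or (A B : form)
| Imp (A B : form)
| AllN (A : form)
| ExN (A : form)
| AllF (A : form)
| ExF (A : form).

Declare Scope form_scope.
Delimit Scope form_scope with form.
Bind Scope form_scope with form.

Notation "t ≐ u" := (EqN t u) (at level 70, no associativity) : form_scope.
Notation "A ∧ B" := (And A B) (at level 80, right associativity) : form_scope.
Notation "A ⟶ B" := (Imp A B) (at level 90, right associativity) : form_scope.
Notation "A ⟷ B" := (And (Imp A B) (Imp B A)) (at level 95, no associativity) : form_scope.
Notation "¬ A" := (Imp A Bot) (at level 75, right associativity) : form_scope.
Local Open Scope form_scope.

Definition scons {X} (x : X) (s : nat -> X) (k : nat) : X :=
  match k with 0 => x | S j => s j end.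

Definition fsubst (τ : nat -> fterm) (f : fterm) : fterm :=
  match f with FVar k => τ k | FPr c => FPr c end.

Fixpoint nsubst (σ : nat -> nterm) (τ : nat -> fterm) (t : nterm) : nterm :=
  match t with
  | NVar k => σ k
  | NPr f ts => NPr f (Vector.map (nsubst σ τ) ts)
  | NAp f t => NAp (fsubst τ f) (nsubst σ τ t)
  end.

(** Weakening by one number variable, resp. one function variable. *)
Definition nshift (t : nterm) : nterm := nsubst (fun k => NVar (S k)) FVar t.
Definition nshiftF (t : nterm) : nterm := nsubst NVar (fun k => FVar (S k)) t.
Definition fshift (f : fterm) : fterm := fsubst (fun k => FVar (S k)) f.

Definition upN (σ : nat -> nterm) : nat -> nterm := scons (NVar 0) (fun k => nshift (σ k)).
Definition upNF (σ : nat -> nterm) : nat -> nterm := fun k => nshiftF (σ k).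
Definition upF (τ : nat -> fterm) : nat -> fterm := scons (FVar 0) (fun k => fshift (τ k)).

Fixpoint subst (σ : nat -> nterm) (τ : nat -> fterm) (A : form) : form :=
  match A with
  | EqN t u => EqN (nsubst σ τ t) (nsubst σ τ u)
  | EqF f g => EqF (fsubst τ f) (fsubst τ g)
  | Bot => Bot
  | And A B => And (subst σ τ A) (subst σ τ B)
  | Or A B => Or (subst σ τ A) (subst σ τ B)
  | Imp A B => Imp (subst σ τ A) (subst σ τ B)
  | AllN A => AllN (subst (upN σ) τ A)
  | ExN A => ExN (subst (upN σ) τ A)
  | AllF A => AllF (subst (upNF σ) (upF τ) A)
  | ExF A => ExF (subst (upNF σ) (upF τ) A)
  end.

Definition instN (t : nterm) (A : form) : form := subst (scons t NVar) FVar A.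
Definition instF (f : fterm) (A : form) : form := subst NVar (scons f FVar) A.
Definition shiftN (A : form) : form := subst (fun k => NVar (S k)) FVar A.
Definition shiftF (A : form) : form := subst NVar (fun k => FVar (S k)) A.

(** * Intuitionistic natural deduction with equality over a set [T] of nonlogical axioms *)

Inductive prv (T : form -> Prop) : list form -> form -> Prop :=
| Hyp Γ A : List.In A Γ -> prv T Γ A
| Ax Γ A : T A -> prv T Γ A
| BotE Γ A : prv T Γ Bot -> prv T Γ A
| AndI Γ A B : prv T Γ A -> prv T Γ B -> prv T Γ (And A B)
| AndE1 Γ A B : prv T Γ (And A B) -> prv T Γ A
| AndE2 Γ A B : prv T Γ (And A B) -> prv T Γ B
| OrI1 Γ A B : prv T Γ A -> prv T Γ (Or A B)
| OrI2 Γ A B : prv T Γ B -> prv T Γ (Or A B)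
| OrE Γ A B C :
    prv T Γ (Or A B) -> prv T (A :: Γ)%list C -> prv T (B :: Γ)%list C -> prv T Γ C
| ImpI Γ A B : prv T (A :: Γ)%list B -> prv T Γ (Imp A B)
| ImpE Γ A B : prv T Γ (Imp A B) -> prv T Γ A -> prv T Γ B
| AllNI Γ A : prv T (List.map shiftN Γ) A -> prv T Γ (AllN A)
| AllNE Γ A t : prv T Γ (AllN A) -> prv T Γ (instN t A)
| ExNI Γ A t : prv T Γ (instN t A) -> prv T Γ (ExN A)
| ExNE Γ A C :
    prv T Γ (ExN A) -> prv T (A :: List.map shiftN Γ)%list (shiftN C) -> prv T Γ C
| AllFI Γ A : prv T (List.map shiftF Γ) A -> prv T Γ (AllF A)
| AllFE Γ A f : prv T Γ (AllF A) -> prv T Γ (instF f A)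
| ExFI Γ A f : prv T Γ (instF f A) -> prv T Γ (ExF A)
| ExFE Γ A C :
    prv T Γ (ExF A) -> prv T (A :: List.map shiftF Γ)%list (shiftF C) -> prv T Γ C
| EqNI Γ t : prv T Γ (EqN t t)
| EqNE Γ A t u : prv T Γ (EqN t u) -> prv T Γ (instN t A) -> prv T Γ (instN u A)
| EqFI Γ f : prv T Γ (EqF f f)
| EqFE Γ A f g : prv T Γ (EqF f g) -> prv T Γ (instF f A) -> prv T Γ (instF g A).

(** * Abbreviations *)

Definition zero : nterm := NPr PZero [].
Definition suc (t : nterm) : nterm := NPr PSucc [t].
Definition pair (t u : nterm) : nterm := NPr pJ [t; u].
Definition snoc (s n : nterm) : nterm := NPr psnoc [s; n].
Definition len (s : nterm) : nterm := NPr plen [s].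
Definition ent (s i : nterm) : nterm := NPr pent [s; i].

Definition le (t u : nterm) : form := NPr psub [t; u] ≐ zero.
Definition lt (t u : nterm) : form := le (suc t) u.

Local Notation x0 := (NVar 0).
Local Notation x1 := (NVar 1).
Local Notation x2 := (NVar 2).
Local Notation f0 := (FVar 0).
Local Notation f1 := (FVar 1).
Local Notation f2 := (FVar 2).

(** * The theory BIM

    As usual, [α(m,n)] is [α(J(m,n))], and [α(m,n,p)] is [α(J(J(m,n),p))].
    Schemes are stated with arbitrary terms and with free variables as parameters. *)

Inductive BIM : form -> Prop :=
| ax_ext : BIM (AllF (AllF (EqF f1 f0 ⟷ AllN (NAp f1 x0 ≐ NAp f0 x0))))
| ax_suc_zero : BIM (AllN (¬ (suc x0 ≐ zero)))
| ax_suc_inj : BIM (AllN (AllN (suc x1 ≐ suc x0 ⟶ x1 ≐ x0)))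
| ax_const (c : pr 1) : BIM (AllN (NAp (FPr c) x0 ≐ NPr c [x0]))
| ax_proj n (i : Fin.t n) ts : BIM (NPr (PProj i) ts ≐ Vector.nth ts i)
| ax_comp m n (f : pr m) (gs : Vector.t (pr n) m) ts :
    BIM (NPr (PComp f gs) ts ≐ NPr f (Vector.map (fun g => NPr g ts) gs))
| ax_rec_zero n (f : pr n) g ts :
    BIM (NPr (PRec f g) (zero :: ts) ≐ NPr f ts)
| ax_rec_suc n (f : pr n) g t ts :
    BIM (NPr (PRec f g) (suc t :: ts) ≐ NPr g (t :: NPr (PRec f g) (t :: ts) :: ts))
| ax_fun_comp :
    BIM (AllF (AllF (ExF (AllN (NAp f0 x0 ≐ NAp f2 (NAp f1 x0))))))
| ax_fun_pair :
    BIM (AllF (AllF (ExF (AllN (NAp f0 x0 ≐ pair (NAp f2 x0) (NAp f1 x0))))))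
| ax_fun_rec :
    BIM (AllF (AllF (ExF (AllN (AllN
      (NAp f0 (pair x1 zero) ≐ NAp f2 x1 ∧
       NAp f0 (pair x1 (suc x0)) ≐
         NAp f1 (pair (pair x1 x0) (NAp f0 (pair x1 x0)))))))))
| ax_fun_search :
    BIM (AllF (AllN (ExN (NAp f0 (pair x1 x0) ≐ zero)) ⟶
      ExF (AllN (NAp f1 (pair x0 (NAp f0 x0)) ≐ zero ∧
        AllN (lt x0 (NAp f0 x1) ⟶ ¬ (NAp f1 (pair x1 x0) ≐ zero))))))
| ax_ind A :
    BIM (instN zero A ∧ AllN (A ⟶ subst (scons (suc x0) (fun k => NVar (S k))) FVar A)
         ⟶ AllN A).

(** * Bars in fans

    A set [B] of natural numbers is given by a formula in which number variable 0 stands for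
    the element; [wkN] and [wkF] weaken its parameters. *)

Definition wkN (B : form) : form := subst (scons x0 (fun k => NVar (S (S k)))) FVar B.
Definition wkF (B : form) : form := shiftF B.

(** [D_α] and [D_a]. *)
Definition Dfun (α : fterm) : form := ¬ (NAp α x0 ≐ zero).
Definition Dcode (a : nterm) : form :=
  lt x0 (len (nshift a)) ∧ ¬ (ent (nshift a) x0 ≐ zero).

Definition initial_part (s t : nterm) : form :=
  le (len s) (len t) ∧
  AllN (lt x0 (len (nshift s)) ⟶ ent (nshift s) x0 ≐ ent (nshift t) x0).

(** [s] is the code of [<α(0), ..., α(n-1)>]. *)
Definition is_init (α : fterm) (n s : nterm) : form :=
  len s ≐ n ∧ AllN (lt x0 (nshift n) ⟶ ent (nshift s) x0 ≐ NAp α x0).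

(** [init α n A] is [A] where number variable 0 stands for the code of
    [<α(0), ..., α(n-1)>]: BIM has no term for this code. *)
Definition init (α : fterm) (n : nterm) (A : form) : form :=
  ExN (is_init α (nshift n) x0 ∧ A).

Definition in_spread (β α : fterm) : form := AllN (init α x0 (NAp β x0 ≐ zero)).

Definition spread_law (β : fterm) : form :=
  AllN (NAp β x0 ≐ zero ⟷ ExN (NAp β (snoc x1 x0) ≐ zero)).

Definition fan_plus (β : fterm) : form :=
  spread_law β ∧
  ExF (AllN (AllN (NAp (fshift β) (snoc x1 x0) ≐ zero ⟶ le x0 (NAp f0 x1)))).

Definition bar (β : fterm) (B : form) : form :=
  AllF (in_spread (fshift β) f0 ⟶ ExN (init f0 x0 (wkN (wkF B)))).

(** A thin bar in the spread [β] consists of sequences admitted by [β]. Without this clause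
    [FT_thin] is refutable: if 0 is the only value of the members of the spread, then the set
    of all sequences of length 1 is an infinite bar without comparable elements. *)
Definition thin_bar (β : fterm) (B : form) : form :=
  bar β B ∧
  AllN (B ⟶ NAp β x0 ≐ zero) ∧
  AllN (AllN (instN x1 (wkN (wkN B)) ∧ instN x0 (wkN (wkN B)) ∧ initial_part x1 x0
              ⟶ x1 ≐ x0)).

Definition FT_ext : form :=
  AllF (AllF (fan_plus f1 ∧ bar f1 (Dfun f0) ⟶
    ExN (init f0 x0 (bar f1 (Dcode x0))))).

Definition FT_thin : form :=
  AllF (fan_plus f0 ⟶
    AllF (thin_bar f1 (Dfun f0) ⟶ ExN (AllN (lt x1 x0 ⟶ NAp f0 x0 ≐ zero)))).

(* Main.v *)
(** If the bar [D_α] is thin and [D_(ᾱn)] is a bar, let [m >= n] be in [D_α]. As [m] is admitted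
    by the spread-law, it is an initial part of some member of the fan, which also has an initial part [t < n]
    in [D_α]; by thinness [t = m], a contradiction. Conversely, the members of a decidable bar
    without proper initial part in the bar form a decidable thin bar; if all of them are at most [n],
    then [D_(ᾱ(n+1))] is a bar.

    To carry this out in BIM, derivability from a context is identified with truth in a Kripke-like
    model whose worlds are contexts, so that derivations become proofs in the metalanguage. *)

Require Import Defs.
From Stdlib Require Vector.
From Stdlib Require Import Arith List FunctionalExtensionality Lia Morphisms Setoid.
Import ListNotations Vector.VectorNotations.
Local Open Scope list_scope.
Arguments Vector.map {A B} f {n} v.

(** * Substitution and fresh variables *)

(** Derivability of an existence formula from a context gives no witness term, so existence is read
    through a continuation modality: a witness may be named while the goal is stable under the
    modality, as derivability is. The elements of the model are open terms, not numerals; hence case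
    distinctions and inductions on numbers, even for arithmetic identities, pass through the
    induction scheme of BIM with an explicit object formula. As contexts are finite, fresh variables
    are always available, and the domain of terms need not grow with the world.

    BIM has neither choice nor comprehension for formulas. Decidable conditions are therefore
    expressed by the vanishing of a term, terms are turned into functions, and choices are made by
    unbounded search. *)

Notation "t .: σ" := (scons t σ) (at level 55, right associativity).

Lemma nterm_ind' (P : nterm -> Prop) :
  (forall k, P (NVar k)) ->
  (forall n (f : pr n) ts, Vector.Forall P ts -> P (NPr f ts)) ->
  (forall f t, P t -> P (NAp f t)) -> forall t, P t.
Proof.
  intros HV HP HA. fix F 1. intros [k|n f ts|f t].
  - exact (HV k).
  - apply HP. clear f. induction ts as [|t n ts IH]; [constructor|]. constructor; [apply F|exact IH].
  - exact (HA f t (F t)).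
Qed.

Lemma map_ext_Forall {X Y} (f g : X -> Y) n (v : Vector.t X n) :
  Vector.Forall (fun x => f x = g x) v -> Vector.map f v = Vector.map g v.
Proof. induction 1; simpl; congruence. Qed.

Lemma fsubst_comp τ τ' f : fsubst τ' (fsubst τ f) = fsubst (fun k => fsubst τ' (τ k)) f.
Proof. destruct f; reflexivity. Qed.

Lemma fsubst_id f : fsubst FVar f = f.
Proof. destruct f; reflexivity. Qed.

Lemma nsubst_comp σ τ σ' τ' t :
  nsubst σ' τ' (nsubst σ τ t) =
  nsubst (fun k => nsubst σ' τ' (σ k)) (fun k => fsubst τ' (τ k)) t.
Proof.
  induction t as [k|n f ts IH|f t IH] using nterm_ind'; simpl.
  - reflexivity.
  - rewrite Vector.map_map. f_equal. now apply map_ext_Forall.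
  - now rewrite IH, fsubst_comp.
Qed.

Lemma nsubst_id t : nsubst NVar FVar t = t.
Proof.
  induction t as [k|n f ts IH|f t IH] using nterm_ind'; simpl.
  - reflexivity.
  - f_equal. rewrite <- (Vector.map_id _ _ ts) at 2. now apply map_ext_Forall.
  - now rewrite IH, fsubst_id.
Qed.

Lemma nsubst_nshift σ τ t : nsubst σ τ (nshift t) = nsubst (fun k => σ (S k)) τ t.
Proof. unfold nshift. now rewrite nsubst_comp. Qed.

Lemma nsubst_nshiftF σ τ t : nsubst σ τ (nshiftF t) = nsubst σ (fun k => τ (S k)) t.
Proof. unfold nshiftF. now rewrite nsubst_comp. Qed.

Lemma upN_comp σ σ' τ' :
  (fun k => nsubst (upN σ') τ' (upN σ k)) = upN (fun k => nsubst σ' τ' (σ k)).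
Proof.
  extensionality k. destruct k; simpl; [reflexivity|].
  rewrite nsubst_nshift. unfold nshift. rewrite nsubst_comp. simpl. f_equal.
  extensionality j. now rewrite fsubst_id.
Qed.

Lemma upF_comp τ τ' :
  (fun k => fsubst (upF τ') (upF τ k)) = upF (fun k => fsubst τ' (τ k)).
Proof.
  extensionality k. destruct k; simpl; [reflexivity|].
  unfold fshift. now rewrite !fsubst_comp.
Qed.

Lemma upNF_comp σ σ' τ' :
  (fun k => nsubst (upNF σ') (upF τ') (upNF σ k)) = upNF (fun k => nsubst σ' τ' (σ k)).
Proof.
  extensionality k. unfold upNF at 2. rewrite nsubst_nshiftF. unfold upNF, nshiftF.
  now rewrite nsubst_comp.
Qed.

Lemma upN_id : upN NVar = NVar.
Proof. extensionality k. now destruct k. Qed.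

Lemma upF_id : upF FVar = FVar.
Proof. extensionality k. now destruct k. Qed.

Lemma subst_comp A : forall σ τ σ' τ',
  subst σ' τ' (subst σ τ A) =
  subst (fun k => nsubst σ' τ' (σ k)) (fun k => fsubst τ' (τ k)) A.
Proof.
  induction A; intros; simpl; rewrite ?nsubst_comp, ?fsubst_comp, ?IHA, ?IHA1, ?IHA2,
    ?upN_comp, ?upF_comp, ?upNF_comp; reflexivity.
Qed.

Lemma subst_id A : subst NVar FVar A = A.
Proof.
  induction A; simpl; rewrite ?nsubst_id, ?fsubst_id, ?upN_id, ?upF_id; try congruence;
    change (upNF NVar) with NVar; congruence.
Qed.

(** Bridge between the environments of [eval], which put a term in front of [σ], and the quantifier
    rules, which instantiate a body already substituted under its binder. *)
Lemma subst_scons t σ τ A : subst (t .: σ) τ A = instN t (subst (upN σ) τ A).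
Proof.
  unfold instN. rewrite subst_comp. f_equal.
  - extensionality k. destruct k; simpl; [reflexivity|].
    rewrite nsubst_nshift. simpl. now rewrite nsubst_id.
  - extensionality k. now rewrite fsubst_id.
Qed.

Lemma subst_sconsF f σ τ A : subst σ (f .: τ) A = instF f (subst (upNF σ) (upF τ) A).
Proof.
  unfold instF. rewrite subst_comp. f_equal.
  - extensionality k. unfold upNF. rewrite nsubst_nshiftF. simpl. now rewrite nsubst_id.
  - extensionality k. destruct k; simpl; [reflexivity|].
    unfold fshift. now rewrite fsubst_comp, fsubst_id.
Qed.

Lemma subst_shiftN σ τ A : subst σ τ (shiftN A) = subst (fun k => σ (S k)) τ A.
Proof. unfold shiftN. now rewrite subst_comp. Qed.

Lemma subst_shiftF σ τ A : subst σ τ (shiftF A) = subst σ (fun k => τ (S k)) A.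
Proof. unfold shiftF. now rewrite subst_comp. Qed.

Lemma subst_upN_shiftN σ τ A : subst (upN σ) τ (shiftN A) = shiftN (subst σ τ A).
Proof.
  rewrite subst_shiftN. unfold shiftN. rewrite subst_comp. f_equal.
  extensionality k. now rewrite fsubst_id.
Qed.

Lemma subst_upF_shiftF σ τ A :
  subst (upNF σ) (upF τ) (shiftF A) = shiftF (subst σ τ A).
Proof. rewrite subst_shiftF. unfold shiftF. now rewrite subst_comp. Qed.

Lemma subst_instN σ τ t A :
  subst σ τ (instN t A) = instN (nsubst σ τ t) (subst (upN σ) τ A).
Proof.
  rewrite <- subst_scons. unfold instN. rewrite subst_comp. f_equal.
  extensionality k. now destruct k.
Qed.

Lemma subst_instF σ τ f A :
  subst σ τ (instF f A) = instF (fsubst τ f) (subst (upNF σ) (upF τ) A).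
Proof.
  rewrite <- subst_sconsF. unfold instF. rewrite subst_comp. f_equal.
  extensionality k. now destruct k.
Qed.

Lemma prv_weaken T Γ A : prv T Γ A -> forall Γ', incl Γ Γ' -> prv T Γ' A.
Proof.
  induction 1; intros Γ' HΓ.
  - apply Hyp; auto.
  - now apply Ax.
  - apply BotE; auto.
  - apply AndI; auto.
  - eapply AndE1; eauto.
  - eapply AndE2; eauto.
  - apply OrI1; auto.
  - apply OrI2; auto.
  - eapply OrE; [apply IHprv1; auto|apply IHprv2|apply IHprv3];
      intros x [|]; simpl; auto.
  - apply ImpI, IHprv. intros x [|]; simpl; auto.
  - eapply ImpE; eauto.
  - apply AllNI, IHprv. now apply incl_map.
  - apply AllNE; auto.
  - eapply ExNI; eauto.
  - eapply ExNE; eauto. apply IHprv2. intros x [|Hx]; [now left|right].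
    revert Hx. now apply incl_map.
  - apply AllFI, IHprv. now apply incl_map.
  - apply AllFE; auto.
  - eapply ExFI; eauto.
  - eapply ExFE; eauto. apply IHprv2. intros x [|Hx]; [now left|right].
    revert Hx. now apply incl_map.
  - apply EqNI.
  - eapply EqNE; eauto.
  - apply EqFI.
  - eapply EqFE; eauto.
Qed.

Lemma prv_subst T (HT : forall A σ τ, T A -> T (subst σ τ A)) Γ A :
  prv T Γ A -> forall σ τ, prv T (map (subst σ τ) Γ) (subst σ τ A).
Proof.
  assert (HN : forall σ τ Γ,
    map (subst (upN σ) τ) (map shiftN Γ) = map shiftN (map (subst σ τ) Γ)).
  { intros. rewrite !map_map. apply map_ext. intros. apply subst_upN_shiftN. }
  assert (HF : forall σ τ Γ,
    map (subst (upNF σ) (upF τ)) (map shiftF Γ) = map shiftF (map (subst σ τ) Γ)).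
  { intros. rewrite !map_map. apply map_ext. intros. apply subst_upF_shiftF. }
  induction 1; intros σ τ; simpl in *.
  - apply Hyp. now apply in_map.
  - apply Ax; auto.
  - apply BotE. apply IHprv.
  - apply AndI; auto.
  - eapply AndE1. apply IHprv.
  - eapply AndE2. apply IHprv.
  - apply OrI1; auto.
  - apply OrI2; auto.
  - eapply OrE; [apply IHprv1|apply IHprv2|apply IHprv3].
  - apply ImpI, IHprv.
  - eapply ImpE; [apply IHprv1|apply IHprv2].
  - apply AllNI. rewrite <- HN. apply IHprv.
  - rewrite subst_instN. apply AllNE, IHprv.
  - eapply ExNI. rewrite <- subst_instN. apply IHprv.
  - eapply ExNE; [apply IHprv1|]. rewrite <- HN, <- subst_upN_shiftN. apply IHprv2.
  - apply AllFI. rewrite <- HF. apply IHprv.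
  - rewrite subst_instF. apply AllFE, IHprv.
  - eapply ExFI. rewrite <- subst_instF. apply IHprv.
  - eapply ExFE; [apply IHprv1|]. rewrite <- HF, <- subst_upF_shiftF. apply IHprv2.
  - apply EqNI.
  - rewrite subst_instN in *. eapply EqNE; [apply IHprv1|].
    rewrite <- subst_instN. apply IHprv2.
  - apply EqFI.
  - rewrite subst_instF in *. eapply EqFE; [apply IHprv1|].
    rewrite <- subst_instF. apply IHprv2.
Qed.

Lemma BIM_subst A σ τ : BIM A -> BIM (subst σ τ A).
Proof.
  (* Substitution computes to another instance of the same axiom, except for the projection,
     composition and induction schemes treated below. *)
  destruct 1 as [| | |c|n i ts|m n f gs ts| | | | | | |A]; try (constructor; fail).
  - simpl. rewrite <- (Vector.nth_map (nsubst σ τ) ts i i eq_refl). apply ax_proj.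
  - simpl. rewrite Vector.map_map. apply (ax_comp m n f gs (Vector.map (nsubst σ τ) ts)).
  - replace (subst σ τ _) with (instN zero (subst (upN σ) τ A) ∧
      AllN (subst (upN σ) τ A ⟶
        subst (scons (suc (NVar 0)) (fun k => NVar (S k))) FVar (subst (upN σ) τ A))
      ⟶ AllN (subst (upN σ) τ A))%form; [apply ax_ind|].
    simpl. rewrite subst_instN. rewrite !subst_comp. do 4 f_equal.
    f_equal.
    + extensionality k. destruct k; simpl; [reflexivity|]. rewrite nsubst_nshift. reflexivity.
    + extensionality k. now rewrite fsubst_id.
Qed.

Definition agree (n : nat) (σ σ' : nat -> nterm) (τ τ' : nat -> fterm) : Prop :=
  forall k, k < n -> σ k = σ' k /\ τ k = τ' k.

Lemma agree_upN n σ σ' τ τ' : agree n σ σ' τ τ' -> agree n (upN σ) (upN σ') τ τ'.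
Proof.
  intros H k Hk. split; [|now apply H]. destruct k as [|k]; simpl; [reflexivity|].
  destruct (H k) as [-> _]; [lia|reflexivity].
Qed.

Lemma agree_upF n σ σ' τ τ' :
  agree n σ σ' τ τ' -> agree n (upNF σ) (upNF σ') (upF τ) (upF τ').
Proof.
  intros H k Hk. split; [unfold upNF; now destruct (H k Hk) as [-> _]|].
  destruct k as [|k]; simpl; [reflexivity|].
  destruct (H k) as [_ ->]; [lia|reflexivity].
Qed.

Lemma nterm_finite t : exists n, forall σ σ' τ τ',
  agree n σ σ' τ τ' -> nsubst σ τ t = nsubst σ' τ' t.
Proof.
  assert (HF : forall f, exists n, forall σ σ' τ τ',
    agree n σ σ' τ τ' -> fsubst τ f = fsubst τ' f).
  { intros [k|c]; [exists (S k)|exists 0]; intros σ σ' τ τ' H; simpl; [|reflexivity].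
    apply H. lia. }
  induction t as [k|n f ts IH|f t [n Hn]] using nterm_ind'; simpl.
  - exists (S k). intros σ σ' τ τ' H. apply H. lia.
  - enough (exists m, forall σ σ' τ τ', agree m σ σ' τ τ' ->
      Vector.map (nsubst σ τ) ts = Vector.map (nsubst σ' τ') ts) as [m Hm].
    { exists m. intros. f_equal. eauto. }
    clear f. induction IH as [|n t ts [a Ha] _ [b Hb]]; [now exists 0|].
    exists (a + b). intros σ σ' τ τ' H. simpl. f_equal.
    + apply Ha. intros k Hk. apply H. lia.
    + apply Hb. intros k Hk. apply H. lia.
  - destruct (HF f) as [m Hm]. exists (n + m). intros σ σ' τ τ' H. f_equal.
    + eapply Hm. intros k Hk. apply H. lia.
    + apply Hn. intros k Hk. apply H. lia.
Qed.

(** One bound serves both sorts of variables, and it need not grow under a binder: variable [k + 1]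
    there takes its value from variable [k]. *)
Lemma form_finite A : exists n, forall σ σ' τ τ',
  agree n σ σ' τ τ' -> subst σ τ A = subst σ' τ' A.
Proof.
  assert (HF : forall f, exists n, forall σ σ' τ τ',
    agree n σ σ' τ τ' -> fsubst τ f = fsubst τ' f).
  { intros f. destruct (nterm_finite (NAp f zero)) as [n Hn]. exists n.
    intros σ σ' τ τ' H. specialize (Hn _ _ _ _ H). now injection Hn. }
  induction A as [t u|f g| |A [n Hn] B [m Hm]|A [n Hn] B [m Hm]|A [n Hn] B [m Hm]
    |A [n Hn]|A [n Hn]|A [n Hn]|A [n Hn]]; simpl.
  1: destruct (nterm_finite t) as [n Hn], (nterm_finite u) as [m Hm].
  2: destruct (HF f) as [n Hn], (HF g) as [m Hm].
  3: now exists 0.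
  1-5: exists (n + m); intros σ σ' τ τ' H; f_equal;
    [eapply Hn|eapply Hm]; intros k Hk; apply H; lia.
  all: exists n; intros σ σ' τ τ' H; f_equal; apply Hn; auto using agree_upN, agree_upF.
Qed.

Lemma forms_finite Γ : exists n, forall A σ σ' τ τ',
  In A Γ -> agree n σ σ' τ τ' -> subst σ τ A = subst σ' τ' A.
Proof.
  induction Γ as [|A Γ [n Hn]]; [now exists 0|].
  destruct (form_finite A) as [m Hm]. exists (n + m).
  intros B σ σ' τ τ' [<-|HB] H; [apply Hm|apply Hn; auto]; intros k Hk; apply H; lia.
Qed.

(** For a fresh [n], these renamings undo the instantiation of variable 0 by [n], and act as
    weakening on everything else. *)
Definition freeN (n k : nat) : nterm := if Nat.eqb k n then NVar 0 else NVar (S k).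
Definition freeF (n k : nat) : fterm := if Nat.eqb k n then FVar 0 else FVar (S k).

Lemma freshN Γ A C : exists n,
  map (subst (freeN n) FVar) Γ = map shiftN Γ /\ subst (freeN n) FVar C = shiftN C /\
  subst (freeN n) FVar (instN (NVar n) A) = A.
Proof.
  (* With [AllN A] in place of [A] the bound concerns the parameters of [A]; stripping the
     quantifier afterwards gives the action of [upN (freeN n)] on [A]. *)
  destruct (forms_finite (C :: AllN A :: Γ)) as [n Hn]. exists n.
  assert (HS : agree n (freeN n) (fun k => NVar (S k)) FVar FVar).
  { intros k Hk. unfold freeN. destruct (Nat.eqb_spec k n); [lia|auto]. }
  split; [|split].
  - apply map_ext_in. intros B HB. apply Hn; simpl; auto.
  - apply Hn; simpl; auto.
  - assert (HA : subst (freeN n) FVar (AllN A) = shiftN (AllN A)) by (apply Hn; simpl; auto).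
    simpl in HA. unfold shiftN in HA. simpl in HA. injection HA as HA.
    rewrite subst_instN, HA. simpl. unfold instN, freeN. rewrite Nat.eqb_refl, subst_comp.
    rewrite <- (subst_id A) at 2. f_equal. extensionality k. now destruct k.
Qed.

Lemma freshF Γ A C : exists n,
  map (subst NVar (freeF n)) Γ = map shiftF Γ /\ subst NVar (freeF n) C = shiftF C /\
  subst NVar (freeF n) (instF (FVar n) A) = A.
Proof.
  destruct (forms_finite (C :: AllF A :: Γ)) as [n Hn]. exists n.
  assert (HS : agree n NVar NVar (freeF n) (fun k => FVar (S k))).
  { intros k Hk. unfold freeF. destruct (Nat.eqb_spec k n); [lia|auto]. }
  split; [|split].
  - apply map_ext_in. intros B HB. apply Hn; simpl; auto.
  - apply Hn; simpl; auto.
  - assert (HA : subst NVar (freeF n) (AllF A) = shiftF (AllF A)) by (apply Hn; simpl; auto).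
    unfold shiftF in HA. simpl in HA. injection HA as HA.
    rewrite subst_instF, HA. simpl. unfold instF, freeF. rewrite Nat.eqb_refl, subst_comp.
    rewrite <- (subst_id A) at 2. f_equal. extensionality k. now destruct k.
Qed.

(** The instance at a fresh variable is already generic: renaming that variable to 0 yields the
    premise of the eigenvariable rule. This is why a constant domain suffices in the model below. *)
Lemma allN_intro Γ A : (forall t, prv BIM Γ (instN t A)) -> prv BIM Γ (AllN A).
Proof.
  intros H. destruct (freshN Γ A Bot) as (n & HΓ & _ & HA). apply AllNI.
  rewrite <- HΓ, <- HA. apply prv_subst; [apply BIM_subst|apply H].
Qed.

Lemma allF_intro Γ A : (forall f, prv BIM Γ (instF f A)) -> prv BIM Γ (AllF A).
Proof.
  intros H. destruct (freshF Γ A Bot) as (n & HΓ & _ & HA). apply AllFI.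
  rewrite <- HΓ, <- HA. apply prv_subst; [apply BIM_subst|apply H].
Qed.

Lemma exN_elim Γ A C :
  prv BIM Γ (ExN A) -> (forall t, prv BIM (instN t A :: Γ) C) -> prv BIM Γ C.
Proof.
  intros HE H. destruct (freshN Γ A C) as (n & HΓ & HC & HA). apply (ExNE _ _ _ _ HE).
  rewrite <- HΓ, <- HC. rewrite <- HA at 1.
  apply (prv_subst _ BIM_subst _ _ (H (NVar n)) (freeN n) FVar).
Qed.

Lemma exF_elim Γ A C :
  prv BIM Γ (ExF A) -> (forall f, prv BIM (instF f A :: Γ) C) -> prv BIM Γ C.
Proof.
  intros HE H. destruct (freshF Γ A C) as (n & HΓ & HC & HA). apply (ExFE _ _ _ _ HE).
  rewrite <- HΓ, <- HC. rewrite <- HA at 1.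
  apply (prv_subst _ BIM_subst _ _ (H (FVar n)) NVar (freeF n)).
Qed.

(** * Forcing semantics *)

Definition ctx := list form.

Definition eqn (Γ : ctx) (t u : nterm) : Prop := prv BIM Γ (EqN t u).

(** The modality under which existence and disjunction are interpreted: [P] may be used in the
    derivation of any formula, possibly in a larger context. *)
Definition cps (P : ctx -> Prop) (Γ : ctx) : Prop :=
  forall Γ', incl Γ Γ' -> forall C,
  (forall Γ'', incl Γ' Γ'' -> P Γ'' -> prv BIM Γ'' C) -> prv BIM Γ' C.

Notation exn P := (cps (fun Γ => exists x, P x Γ)).

Definition imp (P Q : ctx -> Prop) (Γ : ctx) : Prop :=
  forall Γ', incl Γ Γ' -> P Γ' -> Q Γ'.

(** A Kripke-style semantics whose worlds are the finite sets of hypotheses, ordered by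
    inclusion, with the open terms as constant domains. By [eval_prv] it is derivability itself,
    but it presents formulas as propositions of the metalanguage. *)
Fixpoint eval (A : form) (σ : nat -> nterm) (τ : nat -> fterm) (Γ : ctx) : Prop :=
  match A with
  | EqN t u => eqn Γ (nsubst σ τ t) (nsubst σ τ u)
  | EqF f g => prv BIM Γ (EqF (fsubst τ f) (fsubst τ g))
  | Bot => prv BIM Γ Bot
  | And A B => eval A σ τ Γ /\ eval B σ τ Γ
  | Or A B => cps (fun Γ => eval A σ τ Γ \/ eval B σ τ Γ) Γ
  | Imp A B => imp (eval A σ τ) (eval B σ τ) Γ
  | AllN A => forall t, eval A (t .: σ) τ Γ
  | ExN A => cps (fun Γ => exists t, eval A (t .: σ) τ Γ) Γ
  | AllF A => forall f, eval A σ (f .: τ) Γ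
  | ExF A => cps (fun Γ => exists f, eval A σ (f .: τ) Γ) Γ
  end.

Class Mono (P : ctx -> Prop) : Prop := mono : forall Γ Γ', incl Γ Γ' -> P Γ -> P Γ'.
(** The algebras of the modality: goals for which a witness hidden under [cps] may be opened. *)
Class Stable (P : ctx -> Prop) : Prop := stable : forall Γ, cps P Γ -> P Γ.

Instance Mono_prv A : Mono (fun Γ => prv BIM Γ A).
Proof. intros Γ Γ' HΓ H. exact (prv_weaken _ _ _ H _ HΓ). Qed.
Instance Mono_eqn t u : Mono (fun Γ => eqn Γ t u).
Proof. apply Mono_prv. Qed.
Instance Mono_and P Q : Mono P -> Mono Q -> Mono (fun Γ => P Γ /\ Q Γ).
Proof. intros HP HQ Γ Γ' HΓ []. split; eapply mono; eauto. Qed.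
Instance Mono_or P Q : Mono P -> Mono Q -> Mono (fun Γ => P Γ \/ Q Γ).
Proof. intros HP HQ Γ Γ' HΓ []; [left|right]; eapply mono; eauto. Qed.
Instance Mono_all X P : (forall x : X, Mono (fun Γ => P Γ x)) -> Mono (fun Γ => forall x, P Γ x).
Proof. intros HP Γ Γ' HΓ H x. exact (HP x _ _ HΓ (H x)). Qed.
Instance Mono_ex X P : (forall x : X, Mono (fun Γ => P Γ x)) -> Mono (fun Γ => exists x, P Γ x).
Proof. intros HP Γ Γ' HΓ [x H]. exists x. exact (HP x _ _ HΓ H). Qed.
Instance Mono_imp P Q : Mono (imp P Q).
Proof. intros Γ Γ' HΓ H Γ'' H'. apply H. eapply incl_tran; eauto. Qed.
Instance Mono_cps P : Mono (cps P).
Proof. intros Γ Γ' HΓ H Γ'' H'. apply H. eapply incl_tran; eauto. Qed.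
Instance Mono_eval A σ τ : Mono (eval A σ τ).
Proof.
  revert σ τ. induction A; intros; simpl; try exact _.
  - exact (Mono_all _ (fun Γ t => eval A (t .: σ) τ Γ) (fun t => IHA _ _)).
  - exact (Mono_all _ (fun Γ f => eval A σ (f .: τ) Γ) (fun f => IHA _ _)).
Qed.

Lemma ret P Γ : Mono P -> P Γ -> cps P Γ.
Proof.
  intros HP H Γ' HΓ C k. apply k; [apply incl_refl|]. eapply mono; eauto.
Qed.

Lemma join P Γ : cps (cps P) Γ -> cps P Γ.
Proof.
  intros H Γ' HΓ C k. apply H; [exact HΓ|]. intros Γ1 H1 H'.
  apply H'; [apply incl_refl|]. intros. apply k; auto. eapply incl_tran; eauto.
Qed.

Lemma cps_map P Q Γ :
  cps P Γ -> (forall Γ', incl Γ Γ' -> P Γ' -> Q Γ') -> cps Q Γ.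
Proof.
  intros H HPQ Γ' HΓ C k. apply H; [exact HΓ|]. intros Γ1 H1 H'. apply k; [exact H1|].
  apply HPQ; auto. eapply incl_tran; eauto.
Qed.

Lemma bind P Q Γ {HQ : Stable Q} :
  cps P Γ -> (forall Γ', incl Γ Γ' -> P Γ' -> Q Γ') -> Q Γ.
Proof. intros H HPQ. apply HQ. eapply cps_map; eauto. Qed.

Instance Stable_prv A : Stable (fun Γ => prv BIM Γ A).
Proof. intros Γ H. apply H; [apply incl_refl|]. auto. Qed.
Instance Stable_eqn t u : Stable (fun Γ => eqn Γ t u).
Proof. apply Stable_prv. Qed.
Instance Stable_and P Q : Stable P -> Stable Q -> Stable (fun Γ => P Γ /\ Q Γ).
Proof.
  intros HP HQ Γ H.
  split; [apply HP|apply HQ]; apply (cps_map _ _ _ H); now intros ? ? [].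
Qed.
Instance Stable_all X P :
  (forall x : X, Stable (fun Γ => P Γ x)) -> Stable (fun Γ => forall x, P Γ x).
Proof. intros HP Γ H x. apply (HP x). eapply cps_map; eauto. Qed.
Instance Stable_imp P Q : Mono P -> Stable Q -> Stable (imp P Q).
Proof.
  intros HP HQ Γ H Γ' HΓ HP'. apply HQ. eapply cps_map; [eapply mono; eassumption|].
  intros Γ1 H1 HPQ. apply HPQ; [apply incl_refl|]. eapply mono; eauto.
Qed.
Instance Stable_cps P : Stable (cps P).
Proof. intros Γ H. now apply join. Qed.

(** [cps] is the impredicative encoding of the elimination rules of disjunction and existence; the
    converse applies it to the formula itself, proved by the introduction rule. For an implication,
    the context extended by its premise is the generic world. *)
Theorem eval_prv A : forall σ τ Γ, eval A σ τ Γ <-> prv BIM Γ (subst σ τ A).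
Proof.
  induction A; intros σ τ Γ; simpl; try reflexivity.
  - rewrite IHA1, IHA2. split; [intros []; now apply AndI|].
    intros H. split; [eapply AndE1|eapply AndE2]; eassumption.
  - split.
    + intros H. apply H; [apply incl_refl|]. intros Γ' _ [H1|H1].
      * now apply OrI1, IHA1.
      * now apply OrI2, IHA2.
    + intros H Γ' HΓ C k. eapply OrE; [eapply prv_weaken; eassumption| |].
      * apply k; [now apply incl_tl|]. left. apply IHA1, Hyp. now left.
      * apply k; [now apply incl_tl|]. right. apply IHA2, Hyp. now left.
  - split.
    + intros H. apply ImpI, IHA2, H; [now apply incl_tl|]. apply IHA1, Hyp. now left.
    + intros H Γ' HΓ H1. apply IHA2. apply IHA1 in H1.
      eapply ImpE; [eapply prv_weaken; eassumption|exact H1].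
  - split.
    + intros H. apply allN_intro. intros t. rewrite <- subst_scons. now apply IHA.
    + intros H t. apply IHA. rewrite subst_scons. now apply AllNE.
  - split.
    + intros H. apply H; [apply incl_refl|]. intros Γ' _ [t Ht].
      apply (ExNI _ _ _ t). rewrite <- subst_scons. apply IHA. exact Ht.
    + intros H Γ' HΓ C k. eapply exN_elim; [eapply prv_weaken; eassumption|].
      intros t. apply k; [now apply incl_tl|]. exists t. apply IHA. rewrite subst_scons.
      apply Hyp. now left.
  - split.
    + intros H. apply allF_intro. intros t. rewrite <- subst_sconsF. now apply IHA.
    + intros H t. apply IHA. rewrite subst_sconsF. now apply AllFE.
  - split.
    + intros H. apply H; [apply incl_refl|]. intros Γ' _ [t Ht].
      apply (ExFI _ _ _ t). rewrite <- subst_sconsF. apply IHA. exact Ht.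
    + intros H Γ' HΓ C k. apply (exF_elim _ _ _ (prv_weaken _ _ _ H _ HΓ)).
      intros t. apply k; [now apply incl_tl|]. exists t. apply IHA. rewrite subst_sconsF.
      apply Hyp. now left.
Qed.

(** On a concrete axiom [eval] computes, so its reading in the metalanguage is available by
    conversion. *)
Lemma eval_axiom A Γ : BIM A -> eval A NVar FVar Γ.
Proof. intros H. apply eval_prv. rewrite subst_id. now apply Ax. Qed.

Lemma eval_subst A σ τ σ' τ' Γ :
  eval (subst σ τ A) σ' τ' Γ <->
  eval A (fun k => nsubst σ' τ' (σ k)) (fun k => fsubst τ' (τ k)) Γ.
Proof. now rewrite !eval_prv, subst_comp. Qed.

Lemma scons_eta {X} (f : nat -> X) : (f 0 .: fun k => f (S k)) = f.
Proof. extensionality k. now destruct k. Qed.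

(** The quantifier over [t] ranges over open terms, so no induction of the metalanguage can replace
    the scheme; the property must be the value of an object formula. *)
Lemma eval_induction A σ τ Γ :
  eval A (zero .: σ) τ Γ ->
  (forall Γ', incl Γ Γ' -> forall t, eval A (t .: σ) τ Γ' -> eval A (suc t .: σ) τ Γ') ->
  forall t, eval A (t .: σ) τ Γ.
Proof.
  intros H0 HS. assert (H := Ax BIM Γ _ (BIM_subst _ σ τ (ax_ind A))).
  apply eval_prv in H. apply (H Γ (incl_refl _)). split.
  - refine (proj2 (eval_subst _ _ _ _ _ _) _).
    now rewrite <- (scons_eta (fun k => nsubst σ τ (scons zero NVar k))).
  - intros t Γ' HΓ Ht. refine (proj2 (eval_subst _ _ _ _ _ _) _).
    rewrite <- (scons_eta (fun k => nsubst (t .: σ) τ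
      (scons (suc (NVar 0)) (fun k => NVar (S k)) k))). now apply HS.
Qed.

Lemma prv_induction A σ τ Γ :
  prv BIM Γ (subst (zero .: σ) τ A) ->
  (forall Γ', incl Γ Γ' -> forall t,
    prv BIM Γ' (subst (t .: σ) τ A) -> prv BIM Γ' (subst (suc t .: σ) τ A)) ->
  forall t, prv BIM Γ (subst (t .: σ) τ A).
Proof.
  intros H0 HS t. apply eval_prv. apply eval_induction.
  - now apply eval_prv.
  - intros Γ' HΓ u Hu. apply eval_prv. apply HS; [exact HΓ|]. now apply eval_prv.
Qed.

Lemma imp_intro Γ A B :
  (forall Γ', incl Γ Γ' -> prv BIM Γ' A -> prv BIM Γ' B) -> prv BIM Γ (A ⟶ B)%form.
Proof. intros H. apply ImpI, H; [now apply incl_tl|]. apply Hyp. now left. Qed.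

(** [ext] passes to the extended context of a goal [forall Γ', incl Γ Γ' -> _] and transports
    there the hypotheses that are monotone; the others are dropped. *)
Ltac transport G G' E :=
  repeat match goal with
  | X : ?T |- _ =>
      lazymatch T with incl _ _ => fail | context [G] => idtac end;
      pattern G in X;
      first [ lazymatch type of X with ?P G =>
                let X' := fresh in
                assert (X' := @mono P _ G G' E X); cbv beta in X'; clear X; rename X' into X
              end
            | clear X ]
  end.
Ltac ext :=
  lazymatch goal with |- forall _, incl _ _ -> _ => idtac | _ => hnf; cbv beta end;
  lazymatch goal with |- forall Γ', incl ?G Γ' -> _ =>
    let G' := fresh "Γ" in let E := fresh in
    intros G' E; tryif is_var G then transport G G' E; clear E; clear G; rename G' into G
    else clear E
  end.

(** Eliminates the modality from [H], for a stable goal. *)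
Tactic Notation "unbox" constr(H) "as" simple_intropattern(p) :=
  lazymatch type of H with cps _ ?G =>
    pattern G;
    lazymatch goal with |- ?Q G => refine (bind _ Q G H _) end;
    cbv beta; ext; intros p
  end.

(** Induction in BIM on the metavariable [x]; [l] and [lf] list the other number and function
    metavariables of the goal. The induction formula is found by replacing these
    by object variables. *)
Ltac reify_list V l i A :=
  lazymatch l with
  | List.nil => A
  | List.cons ?t ?l' =>
      let F := eval pattern t in A in
      lazymatch F with ?B _ =>
        let A' := eval cbv beta in (B (V i)) in reify_list V l' (S i) A'
      end
  end.
Ltac env_of l d :=
  lazymatch l with
  | List.nil => d
  | List.cons ?t ?l' => let e := env_of l' d in constr:(scons t e)
  end.
Ltac induct_on x l lf :=
  let goal_form := lazymatch goal with
    | |- eqn _ ?a ?b => constr:(EqN a b) | |- prv BIM _ ?A => A end in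
  let mk G A := lazymatch goal with
    | |- eqn _ _ _ => lazymatch A with EqN ?a ?b => constr:(eqn G a b) end
    | |- _ => constr:(prv BIM G A) end in
  let G := lazymatch goal with | |- eqn ?G _ _ => G | |- prv BIM ?G _ => G end in
  let F := eval pattern x in goal_form in
  lazymatch F with ?F _ =>
    let A1 := reify_list NVar (List.cons x l) 0 goal_form in
    let A2 := reify_list FVar lf 0 A1 in
    let s := env_of l NVar in
    let t := env_of lf FVar in
    let F0 := eval cbv beta in (F zero) in
    let P0 := mk G F0 in
    refine (prv_induction A2 s t G (_ : P0) _ x);
    [ | ext; let y := fresh x in let IH := fresh "IH" in intros y IH;
        let IHT := eval cbv beta in (F y) in
        let Fy := eval cbv beta in (F (suc y)) in
        lazymatch goal with |- prv BIM ?G' _ =>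
          change (prv BIM G' IHT) in IH; change (prv BIM G' Fy);
          try lazymatch Fy with EqN ?a ?b => change (eqn G' a b) end;
          try lazymatch IHT with EqN ?a ?b => change (eqn G' a b) in IH end
        end;
        clear x; rename y into x ]
  end.
Tactic Notation "induct" constr(x) := induct_on x (@List.nil nterm) (@List.nil fterm).
Tactic Notation "induct" constr(x) "with" constr(l) := induct_on x l (@List.nil fterm).
Tactic Notation "induct" constr(x) "and" constr(lf) := induct_on x (@List.nil nterm) lf.
Tactic Notation "induct" constr(x) "with" constr(l) "and" constr(lf) := induct_on x l lf.

(** * Congruence, and evaluation of primitive recursive terms *)

Lemma cong1 Γ t u σ τ e :
  eqn Γ t u -> eqn Γ (nsubst (t .: σ) τ e) (nsubst (u .: σ) τ e).
Proof.
  intros H.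
  assert (HA : forall v, instN v (EqN (nshift (nsubst (t .: σ) τ e)) (nsubst (upN σ) τ e)) =
    EqN (nsubst (t .: σ) τ e) (nsubst (v .: σ) τ e)).
  { intros v. unfold instN. simpl. f_equal.
    - rewrite nsubst_nshift. apply nsubst_id.
    - rewrite nsubst_comp. f_equal.
      + extensionality k. destruct k; simpl; [reflexivity|].
        rewrite nsubst_nshift. apply nsubst_id.
      + extensionality k. apply fsubst_id. }
  unfold eqn. rewrite <- HA. eapply EqNE; [exact H|]. rewrite HA. apply EqNI.
Qed.

Instance eqn_Equivalence Γ : Equivalence (eqn Γ).
Proof.
  assert (HS : Symmetric (eqn Γ)).
  { intros t u H.
    assert (H1 := EqNE BIM Γ (EqN (NVar 0) (nshift t)) t u H). unfold instN in H1.
    simpl in H1. rewrite !nsubst_nshift in H1. simpl in H1. rewrite !nsubst_id in H1.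
    apply H1, EqNI. }
  split; [intros t; apply EqNI|exact HS|].
  intros t u v H1 H2. apply HS in H1.
  assert (H3 := EqNE BIM Γ (EqN (NVar 0) (nshift v)) u t H1). unfold instN in H3.
  simpl in H3. rewrite !nsubst_nshift in H3. simpl in H3. rewrite !nsubst_id in H3.
  apply H3, H2.
Qed.

Fixpoint venv {n} (ts : Vector.t nterm n) (σ : nat -> nterm) : nat -> nterm :=
  match ts with []%vector => σ | (t :: ts)%vector => t .: venv ts σ end.

Fixpoint vars n k : Vector.t nterm n :=
  match n with 0 => []%vector | S n => (NVar k :: vars n (S k))%vector end.

Lemma venv_add n (ts : Vector.t nterm n) σ k : venv ts σ (n + k) = σ k.
Proof. induction ts; simpl; auto. Qed.

Lemma map_vars n (ts : Vector.t nterm n) σ : forall k ρ,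
  (forall i, ρ (k + i) = venv ts σ i) -> Vector.map (nsubst ρ FVar) (vars n k) = ts.
Proof.
  induction ts as [|t n ts IH]; intros k ρ H; simpl; [reflexivity|]. f_equal.
  - specialize (H 0). now rewrite Nat.add_0_r in H.
  - apply IH. intros i. specialize (H (S i)). now rewrite Nat.add_succ_r in H.
Qed.

(** The equality rule replaces one term at a time, so the arguments are exchanged from left to
    right. *)
Lemma cong_venv Γ n (ts us : Vector.t nterm n) :
  Vector.Forall2 (eqn Γ) ts us ->
  forall e, eqn Γ (nsubst (venv ts NVar) FVar e) (nsubst (venv us NVar) FVar e).
Proof.
  induction 1 as [|n t u ts us H _ IH]; intros e; simpl; [reflexivity|].
  transitivity (nsubst (u .: venv ts NVar) FVar e); [now apply cong1|].
  (* The exchanged head [u] is absorbed into the term, its variables moved past the [n] remaining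
     arguments, so that the induction hypothesis applies to the tail. *)
  set (e' := nsubst (nsubst (fun k => NVar (n + k)) FVar u .: NVar) FVar e).
  assert (He : forall vs : Vector.t nterm n,
    nsubst (u .: venv vs NVar) FVar e = nsubst (venv vs NVar) FVar e').
  { intros vs. unfold e'. rewrite nsubst_comp. f_equal. extensionality k.
    destruct k; simpl; [|reflexivity]. rewrite nsubst_comp. symmetry.
    etransitivity; [|apply nsubst_id]. f_equal. extensionality k. apply venv_add. }
  rewrite !He. apply IH.
Qed.

Lemma cong_NPr Γ n (f : pr n) ts us :
  Vector.Forall2 (eqn Γ) ts us -> eqn Γ (NPr f ts) (NPr f us).
Proof.
  intros H. assert (H1 := cong_venv _ _ _ _ H (NPr f (vars n 0))). simpl in H1.
  now rewrite !(map_vars _ _ NVar 0) in H1 by reflexivity.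
Qed.

Instance NAp_proper Γ : Proper (eq ==> eqn Γ ==> eqn Γ) NAp.
Proof.
  intros f ? <- t u H. exact (cong1 Γ t u NVar (fun _ => f) (NAp (FVar 0) (NVar 0)) H).
Qed.

(** Compositions and projections are unfolded, recursors are left alone: equations that need no
    recursion reduce to syntactic equality of [nf]. *)
Fixpoint peval {n} (f : pr n) : Vector.t nterm n -> nterm :=
  match f in pr n return Vector.t nterm n -> nterm with
  | PZero => fun _ => zero
  | PSucc => fun ts => suc (Vector.hd ts)
  | PProj i => fun ts => Vector.nth ts i
  | PComp f gs => fun ts => peval f (Vector.map (fun g => peval g ts) gs)
  | PRec f g => fun ts => NPr (PRec f g) ts
  end.

Fixpoint nf (t : nterm) : nterm :=
  match t with
  | NVar k => NVar k
  | NPr f ts => peval f (Vector.map nf ts)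
  | NAp f t => NAp f (nf t)
  end.

Lemma peval_eq Γ : forall n (f : pr n) ts, eqn Γ (NPr f ts) (peval f ts).
Proof.
  fix F 2. intros n f. destruct f as [| |n i|m n f gs|n f g]; intros ts; simpl.
  - rewrite (Vector.nil_spec ts). reflexivity.
  - rewrite (Vector.eta ts). rewrite (Vector.nil_spec (Vector.tl ts)). reflexivity.
  - apply Ax, ax_proj.
  - transitivity (NPr f (Vector.map (fun g => NPr g ts) gs)); [apply Ax, ax_comp|].
    transitivity (NPr f (Vector.map (fun g => peval g ts) gs)); [|apply F].
    apply cong_NPr. clear f. induction gs as [|g m gs IH]; simpl; constructor.
    + apply F.
    + exact IH.
  - reflexivity.
Qed.

Lemma nf_eq Γ t : eqn Γ t (nf t).
Proof.
  induction t as [k|n f ts IH|f t IH] using nterm_ind'; simpl.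
  - reflexivity.
  - rewrite <- peval_eq. apply cong_NPr. clear f. induction IH; simpl; constructor; auto.
  - now apply NAp_proper.
Qed.

Lemma nf_conv Γ t u : nf t = nf u -> eqn Γ t u.
Proof. intros H. rewrite (nf_eq Γ t), (nf_eq Γ u), H. reflexivity. Qed.

Lemma rec_zero Γ n (f : pr n) g ts u :
  nf (NPr f ts) = nf u -> eqn Γ (NPr (PRec f g) (zero :: ts)%vector) u.
Proof. intros H. rewrite <- (nf_conv Γ _ _ H). apply Ax, ax_rec_zero. Qed.

Lemma rec_suc Γ n (f : pr n) g t ts u :
  nf (NPr g (t :: NPr (PRec f g) (t :: ts) :: ts)%vector) = nf u ->
  eqn Γ (NPr (PRec f g) (suc t :: ts)%vector) u.
Proof. intros H. rewrite <- (nf_conv Γ _ _ H). apply Ax, ax_rec_suc. Qed.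

(** * Arithmetic and sequence codes in BIM *)

Definition add t u := NPr padd [t; u]%vector.
Definition sub t u := NPr psub [t; u]%vector.
Definition prd t := NPr ppred [t]%vector.
Definition null t := NPr pnull [t]%vector.
Definition tri t := NPr ptri [t]%vector.
Definition diag t := NPr pdiag [t]%vector.
Definition unK t := NPr pK [t]%vector.
Definition unL t := NPr pL [t]%vector.
Definition cut t u := NPr pcut [t; u]%vector.

Lemma cong_NPr1 (f : pr 1) Γ : Proper (eqn Γ ==> eqn Γ) (fun t => NPr f [t]%vector).
Proof. intros t t' H. apply cong_NPr. repeat (constructor; [assumption|]); constructor. Qed.
Lemma cong_NPr2 (f : pr 2) Γ :
  Proper (eqn Γ ==> eqn Γ ==> eqn Γ) (fun t u => NPr f [t; u]%vector).
Proof. intros t t' H u u' H'. apply cong_NPr. repeat (constructor; [assumption|]); constructor. Qed.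

Instance suc_proper Γ : Proper (eqn Γ ==> eqn Γ) suc := cong_NPr1 PSucc Γ.
Instance prd_proper Γ : Proper (eqn Γ ==> eqn Γ) prd := cong_NPr1 _ Γ.
Instance null_proper Γ : Proper (eqn Γ ==> eqn Γ) null := cong_NPr1 _ Γ.
Instance tri_proper Γ : Proper (eqn Γ ==> eqn Γ) tri := cong_NPr1 _ Γ.
Instance diag_proper Γ : Proper (eqn Γ ==> eqn Γ) diag := cong_NPr1 _ Γ.
Instance unK_proper Γ : Proper (eqn Γ ==> eqn Γ) unK := cong_NPr1 _ Γ.
Instance unL_proper Γ : Proper (eqn Γ ==> eqn Γ) unL := cong_NPr1 _ Γ.
Instance len_proper Γ : Proper (eqn Γ ==> eqn Γ) len := cong_NPr1 _ Γ.
Instance add_proper Γ : Proper (eqn Γ ==> eqn Γ ==> eqn Γ) add := cong_NPr2 _ Γ.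
Instance sub_proper Γ : Proper (eqn Γ ==> eqn Γ ==> eqn Γ) sub := cong_NPr2 _ Γ.
Instance cut_proper Γ : Proper (eqn Γ ==> eqn Γ ==> eqn Γ) cut := cong_NPr2 _ Γ.
Instance pair_proper Γ : Proper (eqn Γ ==> eqn Γ ==> eqn Γ) pair := cong_NPr2 _ Γ.
Instance snoc_proper Γ : Proper (eqn Γ ==> eqn Γ ==> eqn Γ) snoc := cong_NPr2 _ Γ.
Instance ent_proper Γ : Proper (eqn Γ ==> eqn Γ ==> eqn Γ) ent := cong_NPr2 _ Γ.

Lemma add_0_l Γ y : eqn Γ (add zero y) y.
Proof. now apply rec_zero. Qed.
Lemma add_S_l Γ x y : eqn Γ (add (suc x) y) (suc (add x y)).
Proof. now apply rec_suc. Qed.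
Lemma prd_0 Γ : eqn Γ (prd zero) zero.
Proof. now apply rec_zero. Qed.
Lemma prd_S Γ x : eqn Γ (prd (suc x)) x.
Proof. now apply rec_suc. Qed.
Lemma null_0 Γ : eqn Γ (null zero) (suc zero).
Proof. now apply rec_zero. Qed.
Lemma null_S Γ x : eqn Γ (null (suc x)) zero.
Proof. now apply rec_suc. Qed.
Lemma sub_0_r Γ x : eqn Γ (sub x zero) x.
Proof.
  (* [psub] is a recursor behind a swap of its arguments; [peval] performs the swap. *)
  transitivity (peval psub [x; zero]%vector); [apply peval_eq|]. now apply rec_zero.
Qed.
Lemma sub_S_r Γ x y : eqn Γ (sub x (suc y)) (prd (sub x y)).
Proof.
  transitivity (peval psub [x; suc y]%vector); [apply peval_eq|]. now apply rec_suc.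
Qed.
Lemma tri_0 Γ : eqn Γ (tri zero) zero.
Proof. now apply rec_zero. Qed.
Lemma tri_S Γ x : eqn Γ (tri (suc x)) (add (suc x) (tri x)).
Proof. now apply rec_suc. Qed.
Lemma diag_0 Γ : eqn Γ (diag zero) zero.
Proof. now apply rec_zero. Qed.
Lemma diag_S Γ z : eqn Γ (diag (suc z))
  (add (null (sub (tri (suc (diag z))) (suc z))) (diag z)).
Proof. now apply rec_suc. Qed.
Lemma cut_0 Γ s : eqn Γ (cut zero s) s.
Proof. now apply rec_zero. Qed.
Lemma unK_eq Γ z : eqn Γ (unK z) (sub z (tri (diag z))).
Proof. now apply nf_conv. Qed.
Lemma unL_eq Γ z : eqn Γ (unL z) (sub (diag z) (unK z)).
Proof. now apply nf_conv. Qed.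
Lemma pair_eq Γ x y : eqn Γ (pair x y) (add (tri (add x y)) x).
Proof. now apply nf_conv. Qed.
Lemma snoc_eq Γ s n : eqn Γ (snoc s n) (suc (pair s n)).
Proof. now apply nf_conv. Qed.
Lemma ent_eq Γ s i : eqn Γ (ent s i) (unL (prd (cut (sub (len s) (suc i)) s))).
Proof. now apply nf_conv. Qed.

Lemma bot_elim Γ t u : prv BIM Γ Bot -> eqn Γ t u.
Proof. apply BotE. Qed.
Lemma bot_cps P Γ : prv BIM Γ Bot -> cps P Γ.
Proof. intros H Γ' HΓ C _. apply BotE. exact (prv_weaken _ _ _ H _ HΓ). Qed.
Lemma suc_not_zero Γ x : eqn Γ (suc x) zero -> prv BIM Γ Bot.
Proof. apply (eval_axiom _ Γ ax_suc_zero x Γ (incl_refl _)). Qed.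
Lemma suc_inj Γ x y : eqn Γ (suc x) (suc y) -> eqn Γ x y.
Proof. intros H. rewrite <- (prd_S _ x), H. apply prd_S. Qed.

Lemma add_0_r Γ x : eqn Γ (add x zero) x.
Proof.
  induct x.
  - apply add_0_l.
  - now rewrite add_S_l, IH.
Qed.
Lemma add_S_r Γ x y : eqn Γ (add x (suc y)) (suc (add x y)).
Proof.
  induct x with [y].
  - now rewrite !add_0_l.
  - now rewrite !add_S_l, IH.
Qed.
Lemma add_comm Γ x y : eqn Γ (add x y) (add y x).
Proof.
  induct x with [y].
  - now rewrite add_0_l, add_0_r.
  - now rewrite add_S_l, add_S_r, IH.
Qed.
Lemma add_assoc Γ x y z : eqn Γ (add x (add y z)) (add (add x y) z).
Proof.
  induct x with [y; z].
  - now rewrite !add_0_l.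
  - now rewrite !add_S_l, IH.
Qed.

(** As [x] is an open term, even this distinction is an induction in BIM; the predecessor provides
    the witness. *)
Lemma num_case Γ x : cps (fun Γ => eqn Γ x zero \/ exists y, eqn Γ x (suc y)) Γ.
Proof.
  assert (H : prv BIM Γ (Or (x ≐ zero) (x ≐ suc (prd x)))).
  { induct x.
    - apply OrI1, EqNI.
    - apply OrI2. change (eqn Γ (suc x) (suc (prd (suc x)))). now rewrite prd_S. }
  rewrite <- (subst_id (Or _ _)) in H. apply eval_prv in H.
  refine (cps_map _ _ _ H _). intros Γ' _ [H1|H1]; simpl in H1; rewrite nsubst_id in H1; eauto.
Qed.

Definition leq Γ x y : Prop := eqn Γ (sub x y) zero.

Instance leq_proper Γ : Proper (eqn Γ ==> eqn Γ ==> iff) (leq Γ).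
Proof. intros x x' H y y' H'. unfold leq. now rewrite H, H'. Qed.

Lemma sub_SS Γ x y : eqn Γ (sub (suc x) (suc y)) (sub x y).
Proof.
  induct y with [x].
  - now rewrite sub_S_r, !sub_0_r, prd_S.
  - now rewrite sub_S_r, IH, <- sub_S_r.
Qed.
Lemma sub_0_l Γ y : eqn Γ (sub zero y) zero.
Proof.
  induct y.
  - apply sub_0_r.
  - now rewrite sub_S_r, IH, prd_0.
Qed.
Lemma add_sub Γ x y : eqn Γ (sub (add x y) x) y.
Proof.
  induct x with [y].
  - now rewrite add_0_l, sub_0_r.
  - now rewrite add_S_l, sub_SS.
Qed.
Lemma sub_diag Γ x : eqn Γ (sub x x) zero.
Proof. rewrite <- (add_0_r _ x) at 1. apply add_sub. Qed.
Lemma sub_add_distr Γ x y z : eqn Γ (sub x (add y z)) (sub (sub x y) z).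
Proof.
  induct z with [x; y].
  - now rewrite add_0_r, sub_0_r.
  - now rewrite add_S_r, !sub_S_r, IH.
Qed.
Lemma add_cancel_l Γ x y z : eqn Γ (add x y) (add x z) -> eqn Γ y z.
Proof. intros H. now rewrite <- (add_sub _ x y), H, add_sub. Qed.

(** Both sides are the maximum of [x] and [y]; [leq_elim] and [leq_antisym] follow from this. The
    induction formula quantifies over [y], since the step uses the hypothesis at the predecessor of
    [y]. *)
Lemma add_sub_comm Γ x y : eqn Γ (add x (sub y x)) (add y (sub x y)).
Proof.
  revert y.
  refine (eval_induction (AllN (add (NVar 1) (sub (NVar 0) (NVar 1)) ≐
    add (NVar 0) (sub (NVar 1) (NVar 0)))) NVar FVar Γ _ _ x).
  - intros y. change (eqn Γ (add zero (sub y zero)) (add y (sub zero y))).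
    now rewrite add_0_l, sub_0_r, sub_0_l, add_0_r.
  - ext. intros t IH y. change (eqn Γ (add (suc t) (sub y (suc t))) (add y (sub (suc t) y))).
    change (forall y, eqn Γ (add t (sub y t)) (add y (sub t y))) in IH.
    unbox (num_case Γ y) as [H|[z H]]; rewrite H.
    + now rewrite sub_0_l, sub_0_r, add_0_l, add_0_r.
    + now rewrite !sub_SS, !add_S_l, IH.
Qed.

Lemma leq_add Γ x y : leq Γ x (add x y).
Proof. unfold leq. now rewrite sub_add_distr, sub_diag, sub_0_l. Qed.
Lemma leq_intro Γ x y k : eqn Γ y (add x k) -> leq Γ x y.
Proof. intros H. rewrite H. apply leq_add. Qed.
Lemma leq_elim Γ x y : leq Γ x y -> eqn Γ y (add x (sub y x)).
Proof. intros H. red in H. now rewrite add_sub_comm, H, add_0_r. Qed.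
Lemma leq_refl Γ x : leq Γ x x.
Proof. apply sub_diag. Qed.
Lemma leq_trans Γ x y z : leq Γ x y -> leq Γ y z -> leq Γ x z.
Proof.
  intros H1 H2. apply leq_elim in H1, H2. rewrite H2, H1, <- add_assoc. apply leq_add.
Qed.
Lemma leq_antisym Γ x y : leq Γ x y -> leq Γ y x -> eqn Γ x y.
Proof.
  intros H1 H2. red in H1, H2. rewrite <- (add_0_r _ x), <- H2, add_sub_comm, H1.
  apply add_0_r.
Qed.
Lemma leq_0_l Γ x : leq Γ zero x.
Proof. apply sub_0_l. Qed.
Lemma leq_suc Γ x : leq Γ x (suc x).
Proof. apply leq_intro with (suc zero). now rewrite add_S_r, add_0_r. Qed.
Lemma leq_SS Γ x y : leq Γ (suc x) (suc y) <-> leq Γ x y.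
Proof. unfold leq. now rewrite sub_SS. Qed.
Lemma lt_irrefl Γ x : leq Γ (suc x) x -> prv BIM Γ Bot.
Proof.
  intros H. apply leq_elim in H. rewrite add_S_l in H. apply (suc_not_zero _ (sub x (suc x))).
  apply (add_cancel_l _ x). rewrite add_S_r, add_0_r. now symmetry.
Qed.
Lemma leq_0_r Γ x : leq Γ x zero -> eqn Γ x zero.
Proof. intros H. apply leq_antisym; [exact H|apply leq_0_l]. Qed.

Lemma leq_case Γ x y : cps (fun Γ => leq Γ x y \/ leq Γ (suc y) x) Γ.
Proof.
  refine (eval_induction (Or (le (NVar 0) (NVar 1)) (le (suc (NVar 1)) (NVar 0)))
    (y .: NVar) FVar Γ _ _ x).
  - apply ret; [exact _|]. left. apply leq_0_l.
  - ext. intros t IH. change (cps (fun Γ => leq Γ t y \/ leq Γ (suc y) t) Γ) in IH.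
    change (cps (fun Γ => leq Γ (suc t) y \/ leq Γ (suc y) (suc t)) Γ).
    unbox IH as [H|H].
    + unbox (num_case Γ (sub y t)) as [E|[d E]]; apply ret; try exact _;
        apply leq_elim in H; rewrite E in H.
      * right. rewrite leq_SS, H, add_0_r. apply leq_refl.
      * left. apply leq_intro with d. now rewrite H, add_S_l, add_S_r.
    + apply ret; [exact _|]. right. apply leq_trans with t; [exact H|apply leq_suc].
Qed.

Lemma leq_sub Γ x y : leq Γ (sub x y) x.
Proof.
  unbox (leq_case Γ x y) as [H|H].
  - red in H. rewrite H. apply leq_0_l.
  - apply leq_intro with y. rewrite add_comm. apply leq_elim.
    apply leq_trans with (suc y); [apply leq_suc|exact H].
Qed.

Lemma leq_prd Γ x y : leq Γ x y -> leq Γ (prd x) (prd y).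
Proof.
  intros H. apply leq_elim in H. unbox (num_case Γ x) as [E|[z E]].
  - rewrite E, prd_0. apply leq_0_l.
  - rewrite H, E, add_S_l, !prd_S. apply leq_add.
Qed.

Lemma tri_mono Γ x y : leq Γ x y -> leq Γ (tri x) (tri y).
Proof.
  intros H. apply leq_elim in H. rewrite H. generalize (sub y x). clear y H. intros k.
  change (eqn Γ (sub (tri x) (tri (add x k))) zero). induct k with [x].
  - rewrite add_0_r. apply sub_diag.
  - rewrite add_S_r, tri_S. apply leq_trans with (tri (add x k)); [exact IH|].
    rewrite (add_comm _ (suc _)). apply leq_add.
Qed.

(** The bounds locate [z] on its Cantor diagonal, [tri d <= z < tri (d + 1)]. The recursion step of
    [pdiag] moves to the next diagonal exactly when [tri (d + 1) <= z + 1]. *)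
Lemma diag_spec Γ z : leq Γ (tri (diag z)) z /\ leq Γ z (add (tri (diag z)) (diag z)).
Proof.
  refine (eval_induction (And (le (tri (diag (NVar 0))) (NVar 0))
    (le (NVar 0) (add (tri (diag (NVar 0))) (diag (NVar 0))))) NVar FVar Γ _ _ z).
  - change (leq Γ (tri (diag zero)) zero /\ leq Γ zero (add (tri (diag zero)) (diag zero))).
    rewrite diag_0, tri_0. split; apply leq_0_l.
  - ext. clear z. intros z [H1 H2]. change (leq Γ (tri (diag z)) z) in H1.
    change (leq Γ z (add (tri (diag z)) (diag z))) in H2.
    change (leq Γ (tri (diag (suc z))) (suc z) /\
      leq Γ (suc z) (add (tri (diag (suc z))) (diag (suc z)))).
    rewrite diag_S. revert H1 H2. generalize (diag z). intros d H1 H2.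
    unbox (leq_case Γ (tri (suc d)) (suc z)) as [H|H].
    + assert (E := H). red in E. rewrite E, null_0, add_S_l, add_0_l.
      split; [exact H|]. apply leq_trans with (suc (add (tri d) d)); [now rewrite leq_SS|].
      rewrite tri_S, add_S_l, (add_comm _ d), !add_S_l, leq_SS. apply leq_add.
    + assert (E : eqn Γ (null (sub (tri (suc d)) (suc z))) zero).
      { apply leq_elim in H. rewrite H, add_S_l, <- add_S_r, add_sub. apply null_S. }
      rewrite E, add_0_l. rewrite tri_S, add_S_l, leq_SS, add_comm in H.
      split; [|exact H]. apply leq_trans with z; [exact H1|apply leq_suc].
Qed.

Lemma diag_bound Γ d e z :
  leq Γ (suc d) e -> leq Γ (tri e) z -> leq Γ z (add (tri d) d) -> prv BIM Γ Bot.
Proof.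
  intros H H1 H2. apply (lt_irrefl _ (add (tri d) d)).
  apply leq_trans with z; [|exact H2]. apply leq_trans with (tri e); [|exact H1].
  apply leq_trans with (tri (suc d)); [|now apply tri_mono].
  rewrite tri_S, add_S_l, add_comm. apply leq_refl.
Qed.

Lemma diag_unique Γ e z : leq Γ (tri e) z -> leq Γ z (add (tri e) e) -> eqn Γ (diag z) e.
Proof.
  intros H1 H2. destruct (diag_spec Γ z) as [H3 H4].
  unbox (leq_case Γ (diag z) e) as [H|H].
  - unbox (leq_case Γ e (diag z)) as [H'|H'].
    + now apply leq_antisym.
    + apply bot_elim. eapply diag_bound; eassumption.
  - apply bot_elim. eapply diag_bound; eassumption.
Qed.

Lemma diag_pair Γ x y : eqn Γ (diag (pair x y)) (add x y).
Proof.
  rewrite pair_eq. apply diag_unique; [apply leq_add|].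
  apply leq_intro with y. now rewrite add_assoc.
Qed.
Lemma unK_pair Γ x y : eqn Γ (unK (pair x y)) x.
Proof. rewrite unK_eq, diag_pair, pair_eq. apply add_sub. Qed.
Lemma unL_pair Γ x y : eqn Γ (unL (pair x y)) y.
Proof. rewrite unL_eq, diag_pair, unK_pair. apply add_sub. Qed.
Lemma pair_unpair Γ z : eqn Γ (pair (unK z) (unL z)) z.
Proof.
  destruct (diag_spec Γ z) as [H1 H2]. apply leq_elim in H1, H2.
  rewrite <- unK_eq in H1.
  (* The position on a diagonal is at most its index, which makes the truncated subtraction in [unL]
     exact. *)
  assert (H3 : leq Γ (unK z) (diag z)).
  { apply leq_intro with (sub (add (tri (diag z)) (diag z)) z).
    apply (add_cancel_l _ (tri (diag z))). rewrite add_assoc, <- H1. exact H2. }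
  apply leq_elim in H3. now rewrite pair_eq, unL_eq, <- H3.
Qed.

(** * Lengths and entries of sequence codes *)

Definition butlast s := unK (prd s).

Instance butlast_proper Γ : Proper (eqn Γ ==> eqn Γ) butlast.
Proof. intros s t H. unfold butlast. now rewrite H. Qed.

Lemma butlast_snoc Γ s n : eqn Γ (butlast (snoc s n)) s.
Proof. unfold butlast. rewrite snoc_eq, prd_S. apply unK_pair. Qed.
Lemma butlast_0 Γ : eqn Γ (butlast zero) zero.
Proof. unfold butlast. rewrite prd_0, unK_eq. apply sub_0_l. Qed.
Lemma cut_S Γ k s : eqn Γ (cut (suc k) s) (butlast (cut k s)).
Proof. now apply rec_suc. Qed.
Lemma code_case Γ s : cps (fun Γ => eqn Γ s zero \/ exists t n, eqn Γ s (snoc t n)) Γ.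
Proof.
  unbox (num_case Γ s) as [H|[z H]]; (apply ret; [exact _|]); [now left|right].
  exists (unK z), (unL z). now rewrite snoc_eq, pair_unpair.
Qed.

Lemma cut_snoc Γ k s n : eqn Γ (cut (suc k) (snoc s n)) (cut k s).
Proof.
  induct k with [s; n].
  - now rewrite cut_S, !cut_0, butlast_snoc.
  - now rewrite cut_S, IH, cut_S.
Qed.

(** Since [K(z) <= z], each removal lowers a nonzero code. Thus [s] removals exhaust [s], which
    makes [s] a sufficient bound for the count that defines the length. *)
Lemma cut_leq Γ k s : leq Γ (cut k s) (sub s k).
Proof.
  unfold leq. induct k with [s].
  - rewrite cut_0, sub_0_r. apply leq_refl.
  - rewrite cut_S, sub_S_r. apply leq_trans with (prd (cut k s)).
    + unfold butlast. rewrite unK_eq. apply leq_sub.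
    + now apply leq_prd.
Qed.

(** The recursion in [plen]: the number of [j < k] such that [cut j s] is nonzero. *)
Definition pcount : pr 2 :=
  (PRec pzero (padd ∘ [pnull ∘ [pnull ∘ [pcut ∘ [PProj Fin.F1;
    PProj (Fin.FS (Fin.FS Fin.F1))]]]; PProj (Fin.FS Fin.F1)]))%pr.
Definition count k s := NPr pcount [k; s]%vector.

Instance count_proper Γ : Proper (eqn Γ ==> eqn Γ ==> eqn Γ) count := cong_NPr2 _ Γ.

Lemma count_0 Γ s : eqn Γ (count zero s) zero.
Proof. now apply rec_zero. Qed.
Lemma count_S Γ k s : eqn Γ (count (suc k) s) (add (null (null (cut k s))) (count k s)).
Proof. now apply rec_suc. Qed.
Lemma len_eq Γ s : eqn Γ (len s) (count s s).
Proof. now apply nf_conv. Qed.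

(** Cuts beyond [s] are empty and contribute nothing. This absorbs the bound [snoc s n], possibly
    much larger than [suc s], when [len_snoc] compares the two lengths. *)
Lemma count_add Γ k s : eqn Γ (count (add s k) s) (len s).
Proof.
  induct k with [s].
  - now rewrite add_0_r, len_eq.
  - assert (H : eqn Γ (cut (add s k) s) zero).
    { apply leq_0_r. apply leq_trans with (sub s (add s k)); [apply cut_leq|].
      rewrite sub_add_distr, sub_diag, sub_0_l. apply leq_refl. }
    now rewrite add_S_r, count_S, H, null_0, null_S, add_0_l.
Qed.

Lemma count_snoc Γ k s n : eqn Γ (count (suc k) (snoc s n)) (suc (count k s)).
Proof.
  induct k with [s; n].
  - now rewrite count_S, !count_0, cut_0, snoc_eq, null_S, null_0, add_S_l, add_0_l.
  - now rewrite count_S, IH, cut_snoc, add_S_r, <- count_S.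
Qed.

Lemma len_0 Γ : eqn Γ (len zero) zero.
Proof. rewrite len_eq. apply count_0. Qed.
Lemma len_snoc Γ s n : eqn Γ (len (snoc s n)) (suc (len s)).
Proof.
  rewrite len_eq. rewrite (snoc_eq _ s n) at 1. rewrite count_snoc, pair_eq.
  now rewrite add_comm, count_add.
Qed.
Lemma len_butlast Γ s : eqn Γ (len (butlast s)) (prd (len s)).
Proof.
  unbox (code_case Γ s) as [H|(t & n & H)]; rewrite H.
  - now rewrite butlast_0, len_0, prd_0.
  - now rewrite butlast_snoc, len_snoc, prd_S.
Qed.
Lemma len_cut Γ k s : eqn Γ (len (cut k s)) (sub (len s) k).
Proof.
  induct k with [s].
  - now rewrite cut_0, sub_0_r.
  - now rewrite cut_S, len_butlast, IH, sub_S_r.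
Qed.

Lemma ent_snoc_last Γ s n : eqn Γ (ent (snoc s n) (len s)) n.
Proof. rewrite ent_eq, len_snoc, sub_diag, cut_0, snoc_eq, prd_S. apply unL_pair. Qed.
Lemma ent_snoc Γ s n i : leq Γ (suc i) (len s) -> eqn Γ (ent (snoc s n) i) (ent s i).
Proof.
  intros H. apply leq_elim in H. rewrite !ent_eq, len_snoc, sub_SS.
  revert H. generalize (sub (len s) (suc i)). intros d H.
  assert (H' : eqn Γ (sub (len s) i) (suc d)).
  { rewrite H, add_S_l, <- add_S_r. apply add_sub. }
  now rewrite H', cut_snoc.
Qed.
Lemma ent_butlast Γ s i :
  leq Γ (suc i) (len (butlast s)) -> eqn Γ (ent (butlast s) i) (ent s i).
Proof.
  intros Hi. unbox (code_case Γ s) as [H|(t & n & H)].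
  - now rewrite H, butlast_0.
  - rewrite H, butlast_snoc in *. symmetry. now apply ent_snoc.
Qed.
Lemma ent_cut Γ k s i : leq Γ (suc i) (len (cut k s)) -> eqn Γ (ent (cut k s) i) (ent s i).
Proof.
  (* The hypothesis depends on [k], so it has to be part of the induction formula. *)
  enough (H : prv BIM Γ (EqN (sub (suc i) (len (cut k s))) zero ⟶ ent (cut k s) i ≐ ent s i)).
  { intros Hi. exact (ImpE _ _ _ _ H Hi). }
  induct k with [s; i].
  - apply imp_intro. ext. intros _. change (eqn Γ (ent (cut zero s) i) (ent s i)).
    now rewrite cut_0.
  - apply imp_intro. ext. intros Hi. change (leq Γ (suc i) (len (cut (suc k) s))) in Hi.
    change (eqn Γ (ent (cut (suc k) s) i) (ent s i)). rewrite cut_S in *.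
    rewrite ent_butlast by exact Hi. apply (ImpE _ _ _ _ IH).
    change (leq Γ (suc i) (len (cut k s))). rewrite len_butlast in Hi.
    eapply leq_trans; [exact Hi|]. unbox (num_case Γ (len (cut k s))) as [H|[z H]]; rewrite H.
    + rewrite prd_0. apply leq_refl.
    + rewrite prd_S. apply leq_suc.
Qed.

Lemma len_zero_inv Γ s : eqn Γ (len s) zero -> eqn Γ s zero.
Proof.
  intros H. unbox (code_case Γ s) as [H'|(t & n & H')]; [exact H'|].
  apply bot_elim, (suc_not_zero _ (len t)). now rewrite <- (len_snoc _ t n), <- H'.
Qed.
Lemma len_suc_inv Γ s k : eqn Γ (len s) (suc k) ->
  cps (fun Γ => exists t n, eqn Γ s (snoc t n) /\ eqn Γ (len t) k) Γ.
Proof.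
  intros H. unbox (code_case Γ s) as [H'|(t & n & H')].
  - apply bot_cps.
    apply (suc_not_zero _ k). rewrite <- H, H'. apply len_0.
  - apply ret; [exact _|]. exists t, n. split; [exact H'|]. apply suc_inj.
    now rewrite <- (len_snoc _ t n), <- H'.
Qed.

(** * Functions in BIM *)

Lemma code_ext Γ s t : eqn Γ (len s) (len t) ->
  (forall i, imp (fun Γ => leq Γ (suc i) (len s)) (fun Γ => eqn Γ (ent s i) (ent t i)) Γ) ->
  eqn Γ s t.
Proof.
  (* [Q] is the metalanguage reading of the induction formula below. The length is a variable of its
     own, so that both codes can vary in the induction. *)
  set (Q := fun n Γ => forall s t, imp (fun Γ => eqn Γ (len s) n)
    (imp (fun Γ => eqn Γ (len t) n)
    (imp (fun Γ => forall i, imp (fun Γ => leq Γ (suc i) n)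
        (fun Γ => eqn Γ (ent s i) (ent t i)) Γ)
      (fun Γ => eqn Γ s t))) Γ).
  intros Hl Hi. enough (H : forall n, Q n Γ).
  { apply (H (len s) s t Γ (incl_refl _) (reflexivity _) Γ (incl_refl _)
      (symmetry Hl) Γ (incl_refl _) Hi). }
  clear Hl Hi s t.
  apply (eval_induction (AllN (AllN (len (NVar 1) ≐ NVar 2 ⟶ len (NVar 0) ≐ NVar 2 ⟶
    AllN (lt (NVar 0) (NVar 3) ⟶ ent (NVar 2) (NVar 0) ≐ ent (NVar 1) (NVar 0)) ⟶
    NVar 1 ≐ NVar 0))) NVar FVar Γ).
  - change (Q zero Γ). intros s t. ext. intros Hs. ext. intros Ht. ext. intros _.
    apply len_zero_inv in Hs, Ht. now rewrite Hs, Ht.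
  - ext. intros n IH. change (Q n Γ) in IH. change (Q (suc n) Γ). subst Q. cbv beta in *.
    intros s t. ext. intros Hs. ext. intros Ht. ext. intros Hi.
    unbox (len_suc_inv _ _ _ Hs) as (s' & a & Es & Ls).
    unbox (len_suc_inv _ _ _ Ht) as (t' & c & Et & Lt).
    assert (E : eqn Γ a c).
    { specialize (Hi n Γ (incl_refl _) (leq_refl _ _)). cbv beta in Hi.
      rewrite Es, Et in Hi. rewrite <- Ls in Hi at 1. rewrite <- Lt in Hi.
      now rewrite !ent_snoc_last in Hi. }
    rewrite Es, Et, E.
    rewrite (IH s' t' Γ (incl_refl _) Ls Γ (incl_refl _) Lt Γ (incl_refl _)); [reflexivity|].
    intros i. ext. intros H.
    rewrite <- (ent_snoc _ s' a), <- (ent_snoc _ t' c), <- Es, <- Et by now rewrite ?Ls, ?Lt.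
    apply Hi; [apply incl_refl|]. apply leq_trans with n; [exact H|apply leq_suc].
Qed.

Lemma fun_comp f g Γ : cps (fun Γ => exists h, forall x, eqn Γ (NAp h x) (NAp f (NAp g x))) Γ.
Proof. exact (eval_axiom _ Γ ax_fun_comp f g). Qed.
Lemma fun_pair f g Γ :
  cps (fun Γ => exists h, forall x, eqn Γ (NAp h x) (pair (NAp f x) (NAp g x))) Γ.
Proof. exact (eval_axiom _ Γ ax_fun_pair f g). Qed.
Lemma fun_rec f g Γ : cps (fun Γ => exists h, forall x n,
  eqn Γ (NAp h (pair x zero)) (NAp f x) /\
  eqn Γ (NAp h (pair x (suc n))) (NAp g (pair (pair x n) (NAp h (pair x n))))) Γ.
Proof. exact (eval_axiom _ Γ ax_fun_rec f g). Qed.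
Lemma fun_search f Γ :
  (forall m, cps (fun Γ => exists n, eqn Γ (NAp f (pair m n)) zero) Γ) ->
  cps (fun Γ => exists h, forall m, eqn Γ (NAp f (pair m (NAp h m))) zero /\
    forall n, imp (fun Γ => leq Γ (suc n) (NAp h m))
      (imp (fun Γ => eqn Γ (NAp f (pair m n)) zero) (fun Γ => prv BIM Γ Bot)) Γ) Γ.
Proof. exact (eval_axiom _ Γ ax_fun_search f Γ (incl_refl _)). Qed.
Lemma fun_pr c x Γ : eqn Γ (NAp (FPr c) x) (NPr c [x]%vector).
Proof. exact (eval_axiom _ Γ (ax_const c) x). Qed.

(** No function symbol need have the open term [u] as its value; the function is built by induction
    in BIM, composing with the successor at each step. *)
Lemma fun_const u Γ : cps (fun Γ => exists f, forall x, eqn Γ (NAp f x) u) Γ.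
Proof.
  refine (eval_induction (ExF (AllN (NAp (FVar 0) (NVar 0) ≐ NVar 1))) NVar FVar Γ _ _ u).
  - apply ret; [exact _|]. exists (FPr pzero). intros x. change (eqn Γ (NAp (FPr pzero) x) zero).
    rewrite fun_pr. now apply nf_conv.
  - ext. intros t H. change (cps (fun Γ => exists f, forall x, eqn Γ (NAp f x) t) Γ) in H.
    change (cps (fun Γ => exists f, forall x, eqn Γ (NAp f x) (suc t)) Γ).
    unbox H as [f Hf]. unbox (fun_comp (FPr PSucc) f Γ) as [h Hh].
    apply ret; [exact _|]. exists h. intros x. rewrite Hh, fun_pr.
    change (eqn Γ (suc (NAp f x)) (suc t)). now rewrite Hf.
Qed.

(** [detuple n] decodes the code [J(x_1, J(x_2, ... J(x_n, y)))]. *)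
Fixpoint detuple n : Vector.t (pr 1) n :=
  match n with
  | 0 => []%vector
  | S n => (pK :: Vector.map (fun g => g ∘ [pL]) (detuple n))%pr%vector
  end.

Instance Mono_Forall2 n (ts us : Vector.t nterm n) :
  Mono (fun Γ => Vector.Forall2 (eqn Γ) ts us).
Proof.
  intros Γ Γ' HΓ H. induction H; constructor; [|assumption]. eapply Mono_eqn; eassumption.
Qed.

Lemma Forall2_uncons {X} (R : X -> X -> Prop) n x (v : Vector.t X n) w :
  Vector.Forall2 R (x :: v)%vector w -> R x (Vector.hd w) /\ Vector.Forall2 R v (Vector.tl w).
Proof.
  intros H.
  refine (match H in @Vector.Forall2 _ _ _ m v w return
    match v in Vector.t _ k return Vector.t X k -> Prop with
    | []%vector => fun _ => True
    | (x :: v)%vector => fun w => R x (Vector.hd w) /\ Vector.Forall2 R v (Vector.tl w)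
    end w with
    | Vector.Forall2_nil _ => I | Vector.Forall2_cons _ _ _ _ _ H1 H2 => conj H1 H2 end).
Qed.

(** The source of all auxiliary functions below. For a symbol of arbitrary arity, the functions for
    its arguments are packed into one by pairing, and the unary symbol [PComp f (detuple n)] is
    composed with the result. *)
Theorem comprehension t : forall σ τ Γ,
  cps (fun Γ => exists f, forall x, eqn Γ (NAp f x) (nsubst (x .: σ) τ t)) Γ.
Proof.
  induction t as [[|k]|n f ts IH|f t IH] using nterm_ind'; intros σ τ Γ; simpl.
  - apply ret; [exact _|]. exists (FPr (PProj Fin.F1)). intros x. rewrite fun_pr.
    now apply nf_conv.
  - apply fun_const.
  - enough (H : cps (fun Γ => exists c, forall x, Vector.Forall2 (eqn Γ)
        (Vector.map (fun g => NPr g [NAp c x]%vector) (detuple n))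
        (Vector.map (nsubst (x .: σ) τ) ts)) Γ).
    { unbox H as [c Hc]. unbox (fun_comp (FPr (PComp f (detuple n))) c Γ) as [h Hh].
      apply ret; [exact _|]. exists h. intros x. rewrite Hh, fun_pr.
      transitivity (NPr f (Vector.map (fun g => NPr g [NAp c x]%vector) (detuple n))).
      - apply Ax, ax_comp.
      - now apply cong_NPr. }
    clear f. revert Γ. induction IH as [|n t ts Ht _ IH]; intros Γ; simpl.
    (* With no arguments left, the tail of the tuple is arbitrary. *)
    + apply ret; [exact _|]. exists (FPr PSucc). intros x. constructor.
    + unbox (IH Γ) as [c Hc]. unbox (Ht σ τ Γ) as [f Hf].
      unbox (fun_pair f c Γ) as [h Hh]. apply ret; [exact _|]. exists h. intros x.
      constructor.
      * change (eqn Γ (unK (NAp h x)) (nsubst (x .: σ) τ t)).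
        now rewrite Hh, unK_pair, Hf.
      * specialize (Hc x).
        assert (E : eqn Γ (unL (NAp h x)) (NAp c x)) by now rewrite Hh, unL_pair.
        rewrite Vector.map_map. revert Hc. generalize (Vector.map (nsubst (x .: σ) τ) ts).
        clear - E. induction (detuple n) as [|g m gs IH]; simpl; intros us H.
        -- rewrite (Vector.nil_spec us). constructor.
        -- apply Forall2_uncons in H as [H1 H2]. rewrite (Vector.eta us). constructor.
           ++ rewrite <- H1. transitivity (NPr g [unL (NAp h x)]%vector).
              ** apply Ax, (ax_comp _ _ g [pL]%vector).
              ** now apply cong_NPr1.
           ++ now apply IH.
  - unbox (IH σ τ Γ) as [g Hg]. unbox (fun_comp (fsubst τ f) g Γ) as [h Hh].
    apply ret; [exact _|]. exists h. intros x. now rewrite Hh, Hg.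
Qed.

(** The recursion axiom carries a parameter, here fixed to [zero], and passes [J(J(x,k),v)] to the
    step function; [b] forgets [x]. *)
Lemma fun_iter (u : nterm) (g : fterm) Γ : cps (fun Γ => exists e, eqn Γ (NAp e zero) u /\
  forall k, eqn Γ (NAp e (suc k)) (NAp g (pair k (NAp e k)))) Γ.
Proof.
  unbox (fun_const u Γ) as [a Ha].
  unbox (comprehension (NAp (FVar 0) (pair (unL (unK (NVar 0))) (unL (NVar 0))))
    NVar (fun _ => g) Γ) as [b Hb].
  change (forall x, eqn Γ (NAp b x) (NAp g (pair (unL (unK x)) (unL x)))) in Hb.
  unbox (fun_rec a b Γ) as [f Hf].
  unbox (comprehension (NAp (FVar 0) (pair zero (NVar 0))) NVar (fun _ => f) Γ) as [e He].
  change (forall x, eqn Γ (NAp e x) (NAp f (pair zero x))) in He.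
  apply ret; [exact _|]. exists e. split.
  - destruct (Hf zero zero) as [H _]. now rewrite He, H.
  - intros k. destruct (Hf zero k) as [_ H].
    now rewrite !He, H, Hb, unK_pair, !unL_pair.
Qed.

(** * Bars and fans as propositions over contexts *)

Definition non (P : ctx -> Prop) : ctx -> Prop := imp P (fun Γ => prv BIM Γ Bot).

Definition is_code f n s (Γ : ctx) : Prop := eqn Γ (len s) n /\
  forall i, imp (fun Γ => leq Γ (suc i) n) (fun Γ => eqn Γ (ent s i) (NAp f i)) Γ.
Definition in_fan b f (Γ : ctx) : Prop :=
  forall n, exn (fun s Γ => is_code f n s Γ /\ eqn Γ (NAp b s) zero) Γ.
Definition spread b (Γ : ctx) : Prop := forall s,
  imp (fun Γ => eqn Γ (NAp b s) zero) (exn (fun n Γ => eqn Γ (NAp b (snoc s n)) zero)) Γ /\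
  imp (exn (fun n Γ => eqn Γ (NAp b (snoc s n)) zero)) (fun Γ => eqn Γ (NAp b s) zero) Γ.
Definition fan b (Γ : ctx) : Prop := spread b Γ /\
  exn (fun g Γ => forall s m, imp (fun Γ => eqn Γ (NAp b (snoc s m)) zero)
    (fun Γ => leq Γ m (NAp g s)) Γ) Γ.
Definition is_bar b (B : nterm -> ctx -> Prop) (Γ : ctx) : Prop := forall f,
  imp (in_fan b f) (exn (fun n => exn (fun s Γ => is_code f n s Γ /\ B s Γ))) Γ.
Definition initial s t (Γ : ctx) : Prop := leq Γ (len s) (len t) /\
  forall i, imp (fun Γ => leq Γ (suc i) (len s)) (fun Γ => eqn Γ (ent s i) (ent t i)) Γ.
Definition is_thin_bar b (B : nterm -> ctx -> Prop) (Γ : ctx) : Prop := is_bar b B Γ /\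
  (forall s, imp (B s) (fun Γ => eqn Γ (NAp b s) zero) Γ) /\
  (forall s t, imp (fun Γ => B s Γ /\ B t Γ /\ initial s t Γ) (fun Γ => eqn Γ s t) Γ).
Definition supp a s : ctx -> Prop := non (fun Γ => eqn Γ (NAp a s) zero).
Definition supp_code c i (Γ : ctx) : Prop :=
  leq Γ (suc i) (len c) /\ non (fun Γ => eqn Γ (ent c i) zero) Γ.

Definition ft_ext (Γ : ctx) : Prop := forall b a,
  imp (fun Γ => fan b Γ /\ is_bar b (supp a) Γ)
    (exn (fun n => exn (fun c Γ => is_code a n c Γ /\ is_bar b (supp_code c) Γ))) Γ.
Definition ft_thin (Γ : ctx) : Prop := forall b, imp (fan b) (fun Γ => forall a,
  imp (is_thin_bar b (supp a)) (exn (fun n Γ => forall m,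
    imp (fun Γ => leq Γ (suc n) m) (fun Γ => eqn Γ (NAp a m) zero) Γ)) Γ) Γ.

(** The definitions above are shaped so that [eval] computes to them; the weakenings inside [bar]
    and [init] disappear by conversion. *)
Theorem eval_ft Γ : eval (FT_ext ⟷ FT_thin) NVar FVar Γ <->
  imp ft_ext ft_thin Γ /\ imp ft_thin ft_ext Γ.
Proof. reflexivity. Qed.

(** If vanishing is read as truth, [add] is conjunction and [null] is negation. This and the next
    lemmas decode conditions written as terms. *)
Lemma add_eq_0 Γ x y : eqn Γ (add x y) zero -> eqn Γ x zero /\ eqn Γ y zero.
Proof.
  intros H. unbox (num_case Γ x) as [E|[z E]].
  - rewrite E, add_0_l in H. now split.
  - rewrite E, add_S_l in H. apply suc_not_zero in H. split; now apply bot_elim.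
Qed.
Lemma null_eq_suc Γ x y : eqn Γ (null x) (suc y) -> eqn Γ x zero.
Proof.
  intros H. unbox (num_case Γ x) as [E|[z E]]; [exact E|].
  rewrite E, null_S in H. apply bot_elim, (suc_not_zero _ y). now symmetry.
Qed.
Lemma null_eq_0 Γ x : eqn Γ (null x) zero -> eqn Γ x zero -> prv BIM Γ Bot.
Proof. intros H E. rewrite E, null_0 in H. exact (suc_not_zero _ _ H). Qed.
Lemma non_zero_intro Γ x y : eqn Γ x (suc y) -> non (fun Γ => eqn Γ x zero) Γ.
Proof. intros H. ext. intros H'. apply (suc_not_zero _ y). now rewrite <- H. Qed.
Lemma non_zero_elim Γ x : non (fun Γ => eqn Γ x zero) Γ ->
  cps (fun Γ => exists y, eqn Γ x (suc y)) Γ.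
Proof.
  intros H. unbox (num_case Γ x) as [E|E].
  - apply bot_cps. exact (H Γ (incl_refl _) E).
  - apply ret; [exact _|exact E].
Qed.
Lemma sub_sub Γ x y : leq Γ x y -> eqn Γ (sub y (sub y x)) x.
Proof. intros H. apply leq_elim in H. rewrite add_comm in H. rewrite H at 1. apply add_sub. Qed.

(** * Initial parts of functions and members of spreads *)

Lemma is_code_unique Γ f n s t : is_code f n s Γ -> is_code f n t Γ -> eqn Γ s t.
Proof.
  intros [H1 H2] [H3 H4]. apply code_ext; [now rewrite H1, H3|].
  intros i. ext. intros Hi. rewrite H1 in Hi.
  rewrite (H2 i Γ (incl_refl _) Hi), (H4 i Γ (incl_refl _) Hi). reflexivity.
Qed.

(** Makes the initial parts of [f] the values of a function, so that a search can run along them. *)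
Lemma init_fun f Γ : cps (fun Γ => exists e, eqn Γ (NAp e zero) zero /\
  forall k, eqn Γ (NAp e (suc k)) (snoc (NAp e k) (NAp f k))) Γ.
Proof.
  unbox (comprehension (snoc (unL (NVar 0)) (NAp (FVar 0) (unK (NVar 0)))) NVar (fun _ => f) Γ)
    as [g Hg].
  change (forall x, eqn Γ (NAp g x) (snoc (unL x) (NAp f (unK x)))) in Hg.
  unbox (fun_iter zero g Γ) as (e & H0 & HS). apply ret; [exact _|]. exists e.
  split; [exact H0|]. intros k. now rewrite HS, Hg, unL_pair, unK_pair.
Qed.

Lemma init_fun_is_code Γ f e : eqn Γ (NAp e zero) zero ->
  (forall k, eqn Γ (NAp e (suc k)) (snoc (NAp e k) (NAp f k))) ->
  forall k, is_code f k (NAp e k) Γ.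
Proof.
  intros H0 HS.
  assert (HL : forall k, eqn Γ (len (NAp e k)) k).
  { intros k. induct k and [e].
    - now rewrite H0, len_0.
    - now rewrite HS, len_snoc, IH. }
  intros k. split; [apply HL|]. intros i.
  enough (H : prv BIM Γ (EqN (sub (suc i) k) zero ⟶ ent (NAp e k) i ≐ NAp f i)).
  { ext. intros Hi. exact (ImpE _ _ _ _ H Hi). }
  induct k with [i] and [e; f].
  - apply imp_intro. ext. intros Hi. apply leq_0_r in Hi. apply BotE. exact (suc_not_zero _ _ Hi).
  - apply imp_intro. ext. intros Hi. change (leq Γ (suc i) (suc k)) in Hi. rewrite leq_SS in Hi.
    change (eqn Γ (ent (NAp e (suc k)) i) (NAp f i)). rewrite HS.
    unbox (leq_case Γ k i) as [H|H].
    + assert (E : eqn Γ i k) by now apply leq_antisym.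
      rewrite E. transitivity (ent (snoc (NAp e k) (NAp f k)) (len (NAp e k)));
        [now rewrite HL|apply ent_snoc_last].
    + rewrite ent_snoc by now rewrite HL. exact (ImpE _ _ _ _ IH H).
Qed.

Lemma is_code_exists f n Γ : cps (fun Γ => exists s, is_code f n s Γ) Γ.
Proof.
  unbox (init_fun f Γ) as (e & H0 & HS). apply ret; [exact _|]. exists (NAp e n).
  now apply init_fun_is_code.
Qed.

Lemma spread_butlast Γ b s : spread b Γ -> eqn Γ (NAp b s) zero -> eqn Γ (NAp b (butlast s)) zero.
Proof.
  intros HB H. unbox (code_case Γ s) as [E|(t & n & E)].
  - rewrite E in H. now rewrite E, butlast_0.
  - rewrite E, butlast_snoc. apply (HB t); [apply incl_refl|]. apply ret; [exact _|].
    exists n. now rewrite <- E.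
Qed.

Lemma spread_cut Γ b s k : spread b Γ -> eqn Γ (NAp b s) zero -> eqn Γ (NAp b (cut k s)) zero.
Proof.
  intros HB H. induct k with [s] and [b].
  - now rewrite cut_0.
  - rewrite cut_S. now apply spread_butlast.
Qed.

Lemma spread_successor Γ b : spread b Γ -> cps (fun Γ => exists h, forall s,
  imp (fun Γ => eqn Γ (NAp b s) zero) (fun Γ => eqn Γ (NAp b (snoc s (NAp h s))) zero) Γ) Γ.
Proof.
  intros HB.
  (* Unbounded search, applied to [d] with [d(s,n) = 0] iff [b(s) <> 0] or [b(s * <n>) = 0]. *)
  unbox (comprehension (null (add (null (NAp (FVar 0) (snoc (unK (NVar 0)) (unL (NVar 0)))))
    (NAp (FVar 0) (unK (NVar 0))))) NVar (fun _ => b) Γ) as [d Hd].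
  change (forall x, eqn Γ (NAp d x)
    (null (add (null (NAp b (snoc (unK x) (unL x)))) (NAp b (unK x))))) in Hd.
  assert (Hd' : forall s n, eqn Γ (NAp d (pair s n))
    (null (add (null (NAp b (snoc s n))) (NAp b s)))).
  { intros s n. now rewrite Hd, unK_pair, unL_pair. }
  clear Hd.
  assert (HT : forall s, cps (fun Γ => exists n, eqn Γ (NAp d (pair s n)) zero) Γ).
  { intros s. unbox (num_case Γ (NAp b s)) as [E|[y E]].
    - destruct (HB s) as [H _]. specialize (H Γ (incl_refl _) E). unbox H as [n Hn].
      apply ret; [exact _|]. exists n. now rewrite Hd', Hn, null_0, add_S_l, null_S.
    - apply ret; [exact _|]. exists zero. now rewrite Hd', E, add_S_r, null_S. }
  unbox (fun_search d Γ HT) as [h Hh]. apply ret; [exact _|]. exists h. intros s. ext.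
  intros E. destruct (Hh s) as [H _]. rewrite Hd', E, add_0_r in H.
  unbox (num_case Γ (NAp b (snoc s (NAp h s)))) as [E'|[y E']]; [exact E'|].
  rewrite E', null_S, null_0 in H. apply bot_elim. exact (suc_not_zero _ _ H).
Qed.

Lemma spread_extend Γ b m : spread b Γ -> eqn Γ (NAp b m) zero ->
  cps (fun Γ => exists f, in_fan b f Γ /\ is_code f (len m) m Γ) Γ.
Proof.
  intros HB Hm. unbox (spread_successor Γ b HB) as [h Hh].
  unbox (comprehension (snoc (unL (NVar 0)) (NAp (FVar 0) (unL (NVar 0)))) NVar (fun _ => h) Γ)
    as [g Hg].
  change (forall x, eqn Γ (NAp g x) (snoc (unL x) (NAp h (unL x)))) in Hg.
  unbox (fun_iter m g Γ) as (e & H0 & HS').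
  assert (HS : forall k, eqn Γ (NAp e (suc k)) (snoc (NAp e k) (NAp h (NAp e k)))).
  { intros k. now rewrite HS', Hg, unL_pair. }
  clear HS' Hg g.
  (* Entry [i] exists in [e(i + 1)], whose length is [len m + i + 1]. *)
  unbox (comprehension (ent (NAp (FVar 0) (suc (NVar 0))) (NVar 0)) NVar (fun _ => e) Γ)
    as [f Hf].
  change (forall i, eqn Γ (NAp f i) (ent (NAp e (suc i)) i)) in Hf.
  assert (HL : forall k, eqn Γ (len (NAp e k)) (add (len m) k)).
  { intros k. induct k with [m] and [e].
    - now rewrite H0, add_0_r.
    - now rewrite HS, len_snoc, IH, add_S_r. }
  assert (HE : forall k, eqn Γ (NAp b (NAp e k)) zero).
  { intros k. induct k and [b; e].
    - now rewrite H0.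
    - rewrite HS. now apply Hh; [apply incl_refl|]. }
  (* The values of [e] extend one another, so an entry does not depend on the stage at which it is
     read. *)
  assert (HP : forall k d i, imp (fun Γ => leq Γ (suc i) (len (NAp e k)))
    (fun Γ => eqn Γ (ent (NAp e (add k d)) i) (ent (NAp e k) i)) Γ).
  { intros k d i. ext. intros Hi. induct d with [k; i] and [e].
    - now rewrite add_0_r.
    - rewrite add_S_r, HS, ent_snoc; [exact IH|]. eapply leq_trans; [exact Hi|].
      rewrite !HL, add_assoc. apply leq_add. }
  assert (HC : forall k, is_code f (len (NAp e k)) (NAp e k) Γ).
  { intros k. split; [reflexivity|]. intros i. ext. intros Hi. rewrite Hf.
    unbox (leq_case Γ k (suc i)) as [H|H].
    - apply leq_elim in H. rewrite H. symmetry. now apply HP; [apply incl_refl|].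
    - assert (H' := leq_trans _ _ _ _ (leq_suc _ _) H). apply leq_elim in H'. rewrite H' at 1.
      apply HP; [apply incl_refl|]. rewrite HL, add_S_r, leq_SS, add_comm. apply leq_add. }
  assert (HM : is_code f (len m) m Γ).
  { destruct (HC zero) as [_ H]. split; [reflexivity|]. intros i. ext. intros Hi.
    rewrite <- H0 at 1. apply H; [apply incl_refl|]. now rewrite H0. }
  apply ret; [exact _|]. exists f. split; [|exact HM]. intros n.
  unbox (leq_case Γ (len m) n) as [H|H]; (apply ret; [exact _|]).
  - apply leq_elim in H. exists (NAp e (sub n (len m))). split; [|apply HE].
    destruct (HC (sub n (len m))) as [_ H']. split; [now rewrite HL, <- H|].
    intros i. ext. intros Hi. apply H'; [apply incl_refl|]. now rewrite HL, <- H.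
  - apply (leq_trans _ _ _ _ (leq_suc _ _)) in H. exists (cut (sub (len m) n) m).
    split; [|now apply spread_cut].
    assert (E : eqn Γ (len (cut (sub (len m) n) m)) n) by now rewrite len_cut, sub_sub.
    split; [exact E|]. intros i. ext. intros Hi. rewrite ent_cut by now rewrite E.
    destruct HM as [_ H']. apply H'; [apply incl_refl|]. now apply leq_trans with n.
Qed.

(** * The two implications *)

Lemma ext_thin Γ : ft_ext Γ -> ft_thin Γ.
Proof.
  intros HX b. ext. intros [HB Hfun] a. ext. intros (Hbar & Hadm & Hthin).
  specialize (HX b a Γ (incl_refl _) (conj (conj HB Hfun) Hbar)).
  unbox HX as [n HX']. unbox HX' as (c & [Lc Hc] & Hcb).
  clear HX HX'.
  apply ret; [exact _|]. exists n. intros m. ext. intros Hm.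
  unbox (num_case Γ (NAp a m)) as [E|[y E]]; [exact E|].
  apply bot_elim. apply non_zero_intro in E.
  assert (Hbm := Hadm m Γ (incl_refl _) E). cbv beta in Hbm.
  unbox (spread_extend _ _ _ HB Hbm) as (f & Hf & Hfm).
  assert (H := Hcb f Γ (incl_refl _) Hf). unbox H as [k H'].
  unbox H' as (t & [Lt Ht] & Htc & Hts). clear H H'.
  rewrite Lc in Htc.
  assert (Et : supp a t Γ).
  { ext. intros Ha. apply (Hts Γ (incl_refl _)). rewrite <- Ha. now apply Hc; [apply incl_refl|]. }
  destruct Hfm as [_ Hfm].
  assert (Emt : eqn Γ t m).
  (* Both are initial parts of [f], so the one that is not longer is an initial part of the
     other. *)
  { unbox (leq_case Γ k (len m)) as [H|H].
    - apply (Hthin t m Γ (incl_refl _)). split; [exact Et|]. split; [exact E|].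
      split; [now rewrite Lt|]. intros i. ext. intros Hi. rewrite Lt in Hi.
      transitivity (NAp f i); [now apply Ht; [apply incl_refl|]|].
      symmetry. apply Hfm; [apply incl_refl|]. now apply leq_trans with k.
    - symmetry. apply (Hthin m t Γ (incl_refl _)). split; [exact E|]. split; [exact Et|].
      apply (leq_trans _ _ _ _ (leq_suc _ _)) in H.
      split; [now rewrite Lt|]. intros i. ext. intros Hi.
      transitivity (NAp f i); [now apply Hfm; [apply incl_refl|]|].
      symmetry. apply Ht; [apply incl_refl|]. now apply leq_trans with (len m). }
  rewrite Emt in Htc. apply (lt_irrefl _ m).
  apply leq_trans with n; [exact Htc|]. apply leq_trans with (suc n); [apply leq_suc|exact Hm].
Qed.

(** As [f(s,n)] is the sum of the [a(cut(k,s))] for [0 < k <= n], the value [a'(s)] is nonzero iff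
    [s] is admitted, lies in [D_a] and has no proper initial part in [D_a]. *)
Lemma thinning Γ b a : cps (fun Γ => exists f a',
  (forall s, eqn Γ (NAp f (pair s zero)) zero) /\
  (forall s k, eqn Γ (NAp f (pair s (suc k)))
    (add (NAp f (pair s k)) (NAp a (cut (suc k) s)))) /\
  (forall s, eqn Γ (NAp a' s)
    (null (add (null (NAp a s)) (add (NAp b s) (NAp f (pair s (len s)))))))) Γ.
Proof.
  unbox (fun_const zero Γ) as [z Hz].
  unbox (comprehension (add (unL (NVar 0))
    (NAp (FVar 0) (cut (suc (unL (unK (NVar 0)))) (unK (unK (NVar 0)))))) NVar (fun _ => a) Γ)
    as [g Hg].
  change (forall x, eqn Γ (NAp g x)
    (add (unL x) (NAp a (cut (suc (unL (unK x))) (unK (unK x)))))) in Hg.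
  unbox (fun_rec z g Γ) as [f Hf].
  unbox (comprehension (null (add (null (NAp (FVar 0) (NVar 0)))
    (add (NAp (FVar 1) (NVar 0)) (NAp (FVar 2) (pair (NVar 0) (len (NVar 0))))))) NVar
    (a .: b .: f .: FVar) Γ) as [a' Ha'].
  apply ret; [exact _|]. exists f, a'. split; [|split].
  - intros s. destruct (Hf s zero) as [H _]. now rewrite H.
  - intros s k. destruct (Hf s k) as [_ H]. now rewrite H, Hg, !unL_pair, !unK_pair, unL_pair.
  - exact Ha'.
Qed.

(** Partial sums of naturals only grow, so a zero at [n] forces a zero at stage [k + 1], whose last
    summand is the required value. *)
Lemma sum_zero_elim Γ f a s n :
  (forall s k, eqn Γ (NAp f (pair s (suc k)))
    (add (NAp f (pair s k)) (NAp a (cut (suc k) s)))) ->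
  eqn Γ (NAp f (pair s n)) zero ->
  forall k, leq Γ (suc k) n -> eqn Γ (NAp a (cut (suc k) s)) zero.
Proof.
  intros Hf H k Hk. apply leq_elim in Hk. rewrite Hk in H. revert H.
  generalize (sub n (suc k)). clear n Hk. intros d H.
  assert (E : prv BIM Γ (NAp f (pair s (add (suc k) d)) ≐ zero ⟶
    NAp f (pair s (suc k)) ≐ zero)).
  { clear H. induct d with [s; k] and [f].
    - apply imp_intro. ext. intros H. change (eqn Γ (NAp f (pair s (add (suc k) zero))) zero) in H.
      now rewrite add_0_r in H.
    - apply imp_intro. ext. intros H. apply (ImpE _ _ _ _ IH).
      change (eqn Γ (NAp f (pair s (add (suc k) (suc d)))) zero) in H.
      rewrite add_S_r, Hf in H. now apply add_eq_0 in H. }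
  apply (ImpE _ _ _ _ E) in H. change (eqn Γ (NAp f (pair s (suc k))) zero) in H.
  rewrite Hf in H. now apply add_eq_0 in H.
Qed.

Lemma sum_zero_intro Γ f a s n :
  (forall s, eqn Γ (NAp f (pair s zero)) zero) ->
  (forall s k, eqn Γ (NAp f (pair s (suc k)))
    (add (NAp f (pair s k)) (NAp a (cut (suc k) s)))) ->
  (forall k, imp (fun Γ => leq Γ (suc k) n) (fun Γ => eqn Γ (NAp a (cut (suc k) s)) zero) Γ) ->
  eqn Γ (NAp f (pair s n)) zero.
Proof.
  intros H0 HS H.
  (* Stages [k <= n] only: beyond [n] the hypothesis says nothing about the summands. *)
  enough (E : forall k, prv BIM Γ (EqN (sub k n) zero ⟶ NAp f (pair s k) ≐ zero)).
  { exact (ImpE _ _ _ _ (E n) (leq_refl Γ n)). }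
  intros k. induct k with [s; n] and [f].
  - apply imp_intro. ext. intros _. apply H0.
  - apply imp_intro. ext. intros Hk. change (leq Γ (suc k) n) in Hk.
    change (eqn Γ (NAp f (pair s (suc k))) zero). rewrite HS.
    rewrite (H k Γ (incl_refl _) Hk), add_0_r. apply (ImpE _ _ _ _ IH).
    apply leq_trans with (suc k); [apply leq_suc|exact Hk].
Qed.

Lemma cut_init_fun Γ e f k m :
  (forall k, eqn Γ (NAp e (suc k)) (snoc (NAp e k) (NAp f k))) ->
  eqn Γ (cut k (NAp e (add k m))) (NAp e m).
Proof.
  intros HS. induct k with [m] and [e].
  - now rewrite cut_0, add_0_l.
  - now rewrite add_S_l, HS, cut_snoc.
Qed.

(** Along a member of the fan, the shortest initial part in [D_a] survives the thinning. Two
    comparable survivors coincide, because a proper initial part of the longer one would contribute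
    a nonzero summand to its sum. *)
Lemma thin_bar_intro Γ b a p a' : spread b Γ -> is_bar b (supp a) Γ ->
  (forall s, eqn Γ (NAp p (pair s zero)) zero) ->
  (forall s k, eqn Γ (NAp p (pair s (suc k)))
    (add (NAp p (pair s k)) (NAp a (cut (suc k) s)))) ->
  (forall s, eqn Γ (NAp a' s)
    (null (add (null (NAp a s)) (add (NAp b s) (NAp p (pair s (len s))))))) ->
  is_thin_bar b (supp a') Γ.
Proof.
  intros HB Hbar H0 HS Ha'.
  assert (HA : forall s, imp (supp a' s) (fun Γ => eqn Γ (null (NAp a s)) zero /\
    eqn Γ (NAp b s) zero /\ eqn Γ (NAp p (pair s (len s))) zero) Γ).
  { intros s. ext. intros H. apply non_zero_elim in H. unbox H as [y Hy].
    rewrite Ha' in Hy. apply null_eq_suc, add_eq_0 in Hy as [H1 H2].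
    apply add_eq_0 in H2. tauto. }
  split; [|split].
  - intros f. ext. intros Hf. assert (H := Hbar f Γ (incl_refl _) Hf).
    unbox H as [n H']. unbox H' as (s & Hs & Has). clear H H'.
    unbox (init_fun f Γ) as (e & E0 & ES).
    assert (HE := init_fun_is_code Γ f e E0 ES).
    assert (En := is_code_unique _ _ _ _ _ (HE n) Hs).
    apply non_zero_elim in Has. unbox Has as [y Hy]. rewrite <- En in Hy.
    (* [d(m,n)] vanishes when the initial part of [f] of length [n] lies in [D_a]. The argument [m]
       is a dummy demanded by the search axiom; the search is read at [zero]. *)
    unbox (comprehension (null (NAp (FVar 0) (NAp (FVar 1) (unL (NVar 0))))) NVar
      (a .: e .: FVar) Γ) as [d Hd].
    change (forall x, eqn Γ (NAp d x) (null (NAp a (NAp e (unL x))))) in Hd.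
    assert (HN : forall m, cps (fun Γ => exists n, eqn Γ (NAp d (pair m n)) zero) Γ).
    { intros m. apply ret; [exact _|]. exists n. now rewrite Hd, unL_pair, Hy, null_S. }
    unbox (fun_search d Γ HN) as [h Hh]. destruct (Hh zero) as [H1 H2]. clear Hh HN.
    revert H1 H2. generalize (NAp h zero). intros N H1 H2. rewrite Hd, unL_pair in H1.
    assert (HL : eqn Γ (len (NAp e N)) N) by apply (HE N).
    (* The proper initial parts of [e(N)] are the [e(r)] with [r < N], and none of them lies in
       [D_a] by minimality of [N]. *)
    assert (Hsum : eqn Γ (NAp p (pair (NAp e N) (len (NAp e N)))) zero).
    { apply (sum_zero_intro Γ p a); [exact H0|exact HS|]. intros k. ext. intros Hk.
      rewrite HL in Hk. apply leq_elim in Hk. revert Hk. generalize (sub N (suc k)).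
      intros r Hr. rewrite Hr at 1. rewrite (cut_init_fun Γ e f) by exact ES.
      unbox (num_case Γ (NAp a (NAp e r))) as [E|[z E]]; [exact E|].
      apply bot_elim. refine (H2 r Γ (incl_refl _) _ Γ (incl_refl _) _).
      - rewrite Hr, add_S_l, leq_SS, add_comm. apply leq_add.
      - now rewrite Hd, unL_pair, E, null_S. }
    apply ret; [exact _|]. exists N. apply ret; [exact _|]. exists (NAp e N).
    split; [apply HE|]. apply non_zero_intro with zero.
    assert (HbN : eqn Γ (NAp b (NAp e N)) zero).
    { assert (H := Hf N). unbox H as (t & Ht & Hbt).
      now rewrite (is_code_unique _ _ _ _ _ (HE N) Ht). }
    now rewrite Ha', H1, HbN, Hsum, !add_0_l, null_0.
  - intros s. ext. intros H. now apply (HA s Γ (incl_refl _)) in H.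
  - intros s t. ext. intros (Hs & Ht & Hlen & Hi).
    destruct (HA s Γ (incl_refl _) Hs) as (Has & _ & _).
    destruct (HA t Γ (incl_refl _) Ht) as (_ & _ & Hsum).
    (* An initial part is recovered by cutting off the difference of the lengths, which brings [s]
       into the form of the summands for [t]. *)
    assert (E : eqn Γ s (cut (sub (len t) (len s)) t)).
    { apply code_ext; [now rewrite len_cut, sub_sub|]. intros i. ext. intros H.
      rewrite ent_cut by now rewrite len_cut, sub_sub.
      apply Hi; [apply incl_refl|exact H]. }
    unbox (num_case Γ (sub (len t) (len s))) as [H|[k H]].
    + now rewrite E, H, cut_0.
    (* Here [a(s)] is a summand of the sum that vanishes for [t], although [s] lies in [D_a]. *)
    + apply bot_elim. rewrite E in Has. rewrite H in Has. apply (null_eq_0 _ _ Has).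
      apply (sum_zero_elim Γ p a t (len t)); [exact HS|exact Hsum|]. rewrite <- H. apply leq_sub.
Qed.

Lemma thin_ext Γ : ft_thin Γ -> ft_ext Γ.
Proof.
  intros HT b a. ext. intros [HB Hbar].
  unbox (thinning Γ b a) as (p & a' & H0 & HS & Ha').
  assert (Hthin := thin_bar_intro Γ b a p a' (proj1 HB) Hbar H0 HS Ha').
  assert (HN := HT b Γ (incl_refl _) HB a' Γ (incl_refl _) Hthin).
  unbox HN as [n Hn]. clear HN. destruct Hthin as [Hbar' _].
  unbox (is_code_exists a (suc n) Γ) as [c Hc].
  apply ret; [exact _|]. exists (suc n). apply ret; [exact _|]. exists c. split; [exact Hc|].
  destruct Hc as [Lc Hc].
  intros f. ext. intros Hf. assert (H := Hbar' f Γ (incl_refl _) Hf).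
  unbox H as [k H']. unbox H' as (s & Hs & Has). clear H H'.
  apply ret; [exact _|]. exists k. apply ret; [exact _|]. exists s. split; [exact Hs|].
  assert (Hsn : leq Γ (suc s) (suc n)).
  { rewrite leq_SS. unbox (leq_case Γ s n) as [H|H]; [exact H|].
    apply bot_elim, (Has Γ (incl_refl _)). now apply Hn; [apply incl_refl|]. }
  (* Entry [s] of [c] is [a(s)]; were it zero, [null (a s)] would be positive and [a'(s)] would
     vanish. *)
  split; [now rewrite Lc|]. ext. intros H.
  assert (Hcs := Hc s Γ (incl_refl _) Hsn). cbv beta in Hcs. rewrite Hcs in H.
  apply (Has Γ (incl_refl _)). rewrite Ha', H, null_0, add_S_l. apply null_S.
Qed.

Theorem theorem3p5 : prv BIM nil (FT_ext ⟷ FT_thin)%form.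
Proof.
  rewrite <- (subst_id (FT_ext ⟷ FT_thin)%form). apply eval_prv, eval_ft.
  split; intros Γ _; [apply ext_thin|apply thin_ext].
Qed.
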